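(* Let $1<p<\infty$, $\gamma_p=(1-\frac1p)^{\frac1p-1}$, and let $\mathcal C$ be either $\mathcal C_p$ (then set $K_{\mathcal C}=2^{1-\frac1p}$) or $\mathcal C_{p,\infty}$ (then set $K_{\mathcal C}=2^{1-\frac1p}\gamma_p$). Let $X_0,X_1,X_2\in\mathcal C$, let $T_1:X_0\to X_1$ be a lattice homomorphism with $\|T_1\|\le1$, let $T_2:X_0\to X_2$ be a lattice isometric embedding, and let $(PO,\widetilde T_1,\widetilde T_2)$ be an isometric push-out of $(T_1,T_2)$ in $\mathcal C$ (i.e. $PO\in\mathcal C$, $\widetilde T_i:X_i\to PO$ lattice homomorphisms of norm $\le1$ with $\widetilde T_1T_1=\widetilde T_2T_2$, and for all $Z\in\mathcal C$ and lattice homomorphisms $R_i:X_i\to Z$ with $R_1T_1=R_2T_2$ there is a unique lattice homomorphism $\gamma:PO\to Z$ with $\gamma\widetilde T_i=R_i$ and $\|\gamma\|\le\max\|R_i\|$). Then $\widetilde T_1$ is a $K_{\mathcal C}$-embedding: $K_{\mathcal C}^{-1}\|x\|\le\|\widetilde T_1x\|\le\|x\|$ for all $x\in X_1$.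
   Context: $\mathcal C_p$ is the class of Banach lattices with $p$-convexity constant $1$ ($\|(\sum|x_k|^p)^{1/p}\|\le(\sum\|x_k\|^p)^{1/p}$ for all finite families), and $\mathcal C_{p,\infty}$ is the class of Banach lattices satisfying an upper $p$-estimate with constant $1$ (the same inequality for pairwise disjoint families). Both classes are closed under closed sublattices, $\ell^\infty$-direct sums and lattice quotients, so isometric push-outs exist in them. *)

(* Defs.v *)
From HB Require Import structures.
From mathcomp Require Import all_boot all_order all_algebra.
From mathcomp Require Import all_classical all_reals all_analysis.
Set Implicit Arguments. Unset Strict Implicit. Unset Printing Implicit Defensive.
Import Order.TTheory GRing.Theory Num.Theory.
Import numFieldNormedType.Exports.
Local Open Scope ring_scope.

Record BanachLattice (R : realType) := {
  BL_carrier :> completeNormedModType R;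
  ble : BL_carrier -> BL_carrier -> Prop;
  bsup : BL_carrier -> BL_carrier -> BL_carrier;
  ble_refl : forall x, ble x x;
  ble_anti : forall x y, ble x y -> ble y x -> x = y;
  ble_trans : forall x y z, ble x y -> ble y z -> ble x z;
  ble_add : forall x y z, ble x y -> ble (x + z) (y + z);
  ble_scale : forall (a : R) x y, 0 <= a -> ble x y -> ble (a *: x) (a *: y);
  bsup_ubl : forall x y, ble x (bsup x y);
  bsup_ubr : forall x y, ble y (bsup x y);
  bsup_least : forall x y z, ble x z -> ble y z -> ble (bsup x y) z;
  babs_norm : forall x y, ble (bsup x (- x)) (bsup y (- y)) -> `|x| <= `|y|
}.

Section Defs.
Variable R : realType.

Definition binf (X : BanachLattice R) (x y : X) : X := - bsup (- x) (- y).
Definition babs (X : BanachLattice R) (x : X) : X := bsup x (- x).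

Definition is_lub (X : BanachLattice R) (S : X -> Prop) (z : X) : Prop :=
  (forall y, S y -> ble y z) /\
  (forall w, (forall y, S y -> ble y w) -> ble z w).

(* z = (sum_k |x_k|^p)^(1/p), described (as usual, cf. Lindenstrauss-Tzafriri
   1.d) as  sup { sum_k a_k x_k : sum_k |a_k|^q <= 1 },  1/p + 1/q = 1. *)
Definition is_pnorm_sum (p : R) (X : BanachLattice R) (n : nat)
    (x : 'I_n -> X) (z : X) : Prop :=
  is_lub (fun y : X => exists a : 'I_n -> R,
             \sum_(k < n) `|a k| `^ (p / (p - 1)) <= 1 /\
             y = \sum_(k < n) a k *: x k) z.

Definition in_Cp (p : R) (X : BanachLattice R) : Prop :=
  forall (n : nat) (x : 'I_n -> X) (z : X), is_pnorm_sum p x z ->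
    `|z| <= (\sum_(k < n) `|x k| `^ p) `^ p^-1.

Definition in_Cpinf (p : R) (X : BanachLattice R) : Prop :=
  forall (n : nat) (x : 'I_n -> X),
    (forall i j : 'I_n, i != j -> binf (babs (x i)) (babs (x j)) = 0) ->
    `|\sum_(k < n) x k| <= (\sum_(k < n) `|x k| `^ p) `^ p^-1.

Inductive lattice_class := ClassCp | ClassCpinf.

Definition in_class (c : lattice_class) (p : R) (X : BanachLattice R) : Prop :=
  match c with ClassCp => in_Cp p X | ClassCpinf => in_Cpinf p X end.

Definition gamma_p (p : R) : R := (1 - p^-1) `^ (p^-1 - 1).

Definition K_class (c : lattice_class) (p : R) : R :=
  match c with
  | ClassCp => 2 `^ (1 - p^-1)
  | ClassCpinf => 2 `^ (1 - p^-1) * gamma_p p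
  end.

Definition lattice_hom (X Y : BanachLattice R) (T : X -> Y) : Prop :=
  (forall x y, T (x + y) = T x + T y) /\
  (forall (a : R) x, T (a *: x) = a *: T x) /\
  (forall x y, T (bsup x y) = bsup (T x) (T y)).

Definition opnorm_le (X Y : BanachLattice R) (T : X -> Y) (c : R) : Prop :=
  forall x, `|T x| <= c * `|x|.

Definition lattice_isometric_embedding (X Y : BanachLattice R) (T : X -> Y) :=
  lattice_hom T /\ forall x, `|T x| = `|x|.

Definition isometric_pushout (c : lattice_class) (p : R)
    (X0 X1 X2 PO : BanachLattice R) (T1 : X0 -> X1) (T2 : X0 -> X2)
    (T1t : X1 -> PO) (T2t : X2 -> PO) : Prop :=
  [/\ in_class c p PO,
      lattice_hom T1t /\ opnorm_le T1t 1,
      lattice_hom T2t /\ opnorm_le T2t 1,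
      (forall x, T1t (T1 x) = T2t (T2 x)) &
      forall (Z : BanachLattice R) (R1 : X1 -> Z) (R2 : X2 -> Z),
        in_class c p Z -> lattice_hom R1 -> lattice_hom R2 ->
        (forall x, R1 (T1 x) = R2 (T2 x)) ->
        exists g : PO -> Z,
          [/\ lattice_hom g, (forall x, g (T1t x) = R1 x),
              (forall x, g (T2t x) = R2 x),
              (* ||g|| <= max(||R1||, ||R2||) *)
              (forall cR : R, opnorm_le R1 cR -> opnorm_le R2 cR ->
                 opnorm_le g cR) &
              (forall g' : PO -> Z, lattice_hom g' ->
                 (forall x, g' (T1t x) = R1 x) ->
                 (forall x, g' (T2t x) = R2 x) -> g' = g)]].

End Defs.

(* Main.v *)
Require Import Defs.
From HB Require Import structures.
From mathcomp Require Import all_boot all_order all_algebra.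
From mathcomp Require Import all_classical all_reals all_analysis.
From mathcomp Require Import ring lra.
Import Order.TTheory GRing.Theory Num.Theory.
Import numFieldNormedType.Exports.
Local Open Scope ring_scope.

(** Fix [x] in [X1], a positive functional [f] norming [|x|], and a positive extension [g] to
    [X2] of [f \o T1].  Split [(f, g)] into finitely many compatible pairs of positive
    functionals, so finely that each is a lattice homomorphism on prescribed finite sets; the
    values of these functionals are coordinates of [X1] and [X2] in which the images of [X0]
    agree.  A Maurey-Pisier factorisation gives weights bounding these coordinates in weighted
    [l_p] (resp. weak [l_p], with constant [gamma_p]).  Averaging the weights coming from [X1]
    and [X2] costs [2 `^ (1 - p^-1)], and a reduced product over all splittings is a lattice of
    the class which receives [X1] and [X2] with norm at most [K_class c p] and in which [x]
    does not lose norm. *)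

Set Implicit Arguments. Unset Strict Implicit. Unset Printing Implicit Defensive.

(** * Hahn-Banach *)

Section HahnBanach.
Variables (R : realType) (V : lmodType R).
Implicit Types (P f : V -> R) (K : V -> R -> Prop).

(** By the universal property, a lattice of the class with commuting legs of norm at most [K]
    receives the push-out with norm at most [K]; so one such lattice in which [x] keeps its norm
    suffices. Splitting makes a positive form exact on finitely many elements only: true
    homomorphisms appear in the limit over ever finer splittings, hence the reduced product. The
    mass of the weights must stay at most [1], for then the test [b = 1] recovers [f |x|]. The
    weights [w] and [w'] obtained on the two sides live on the same cells but are unrelated; their
    mean [h] has mass at most [1] and satisfies [w <= 2 h] and [w' <= 2 h]. As weights enter with
    power [1/q], where [1/p + 1/q = 1], the price is [2^(1/q)]. With [A] the tested value and [B]
    the weighted sum, the weak case yields [t A <= B + t^p/p] for all [t], where the convex case has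
    [B/q] in place of [B]. Minimising over [t] gives [(q B)^(1/q)] instead of [B^(1/q)], and
    [gamma_p = q^(1/q)]. *)

Definition sublinear P :=
  (forall x y, P (x + y) <= P x + P y) /\
  (forall (a : R) x, 0 <= a -> P (a *: x) <= a * P x).

Definition linear_form f :=
  (forall x y, f (x + y) = f x + f y) /\ (forall (a : R) x, f (a *: x) = a * f x).

(** A pair [(u, c)] in [K] stands for the constraint [c <= f u] on a form [f] to be found. *)
Definition convex_cone K :=
  [/\ K 0 0, (forall u v c d, K u c -> K v d -> K (u + v) (c + d)) &
      (forall a u c, 0 <= a -> K u c -> K (a *: u) (a * c))].

Lemma sublinear0 P : sublinear P -> P 0 = 0.
Proof.
move=> [PD PZ]; have := PZ 0 0 (lexx _); have := PD 0 0.
by rewrite scaler0 addr0 mul0r => h1 h2; lra.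
Qed.

Lemma sublinearN P x : sublinear P -> - P (- x) <= P x.
Proof.
by move=> sP; have := sublinear0 sP; have := sP.1 x (- x); rewrite subrr; lra.
Qed.

(** The largest sublinear functional below [P] with value at most [- c] at [- w] for all [(w, c)] in
    [K]; a linear form below it therefore meets every constraint [c <= f w]. *)
Definition conv_inf P K (u : V) : R :=
  inf [set r | exists w c, K w c /\ r = P (u + w) - c]%classic.

Section ConvInf.
Variables (P : V -> R) (K : V -> R -> Prop).
Hypotheses (sP : sublinear P) (cK : convex_cone K).
Hypothesis KP : forall w c, K w c -> c <= P w.

Let lbE u : lbound [set r | exists w c, K w c /\ r = P (u + w) - c]%classic (- P (- u)).
Proof.
move=> _ [w [c [Kwc ->]]].
have := sP.1 (u + w) (- u); rewrite addrAC subrr add0r; have := KP Kwc; lra.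
Qed.

Lemma conv_inf_le u w c : K w c -> conv_inf P K u <= P (u + w) - c.
Proof. by move=> Kwc; apply: ge_inf; [exists (- P (- u))|exists w, c]. Qed.

Lemma le_conv_inf u r :
  (forall w c, K w c -> r <= P (u + w) - c) -> r <= conv_inf P K u.
Proof.
move=> h; apply: lb_le_inf; last by move=> _ [w [c [Kwc ->]]]; exact: h.
by exists (P (u + 0) - 0), 0, 0; split=> //; case: cK.
Qed.

Lemma conv_inf_sublinear : sublinear (conv_inf P K).
Proof.
have [K0 KD KZ] := cK.
split=> [x y|a x].
  have {}h w c : K w c -> conv_inf P K (x + y) - (P (y + w) - c) <= conv_inf P K x.
    move=> Kwc; apply: le_conv_inf => w' c' Kwc'.
    have := conv_inf_le (x + y) (KD _ _ _ _ Kwc' Kwc).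
    have := sP.1 (x + w') (y + w).
    have -> : x + w' + (y + w) = x + y + (w' + w) by rewrite addrACA.
    lra.
  rewrite -lerBlDl; apply: le_conv_inf => w c Kwc.
  have := h _ _ Kwc; lra.
rewrite le0r => /orP[/eqP->|a0].
  rewrite scale0r mul0r; have := conv_inf_le 0 K0.
  by rewrite addr0 (sublinear0 sP) subr0.
rewrite -ler_pdivrMl//; apply: le_conv_inf => w c Kwc.
rewrite ler_pdivrMl// mulrBr.
have := conv_inf_le (a *: x) (KZ _ _ _ (ltW a0) Kwc).
rewrite -scalerDr; have := sP.2 a (x + w) (ltW a0); lra.
Qed.

Lemma conv_inf_leP x : conv_inf P K x <= P x.
Proof. by case: cK => K0 _ _; have := conv_inf_le x K0; rewrite addr0 subr0. Qed.

Lemma conv_infN w c : K w c -> conv_inf P K (- w) <= - c.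
Proof.
move=> Kwc; have := conv_inf_le (- w) Kwc.
by rewrite addNr (sublinear0 sP) sub0r.
Qed.

End ConvInf.

Lemma exists_minimal_sublinear P : sublinear P ->
  exists Q, [/\ sublinear Q, (forall x, Q x <= P x) &
    forall Q', sublinear Q' -> (forall x, Q' x <= Q x) -> forall x, Q' x = Q x].
Proof.
move=> sP.
pose B Q := sublinear Q /\ forall x, Q x <= P x.
pose T := {Q : V -> R | B Q}.
(* The order is reversed, so that the maximal element given by Zorn is a minimal functional. *)
pose r (s t : T) := `[< forall x, sval t x <= sval s x >].
have [||||[Q [sQ QP]] Qmin] := @Zorn T r.
- by move=> t; apply/asboolP.
- move=> s t u /asboolP st /asboolP tu; apply/asboolP => x.
  exact: le_trans (tu x) (st x).
- move=> [s sP'] [t tP'] /asboolP/= st /asboolP/= ts.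
  apply: eq_exist; apply/funext => x; apply/eqP; rewrite eq_le ts st//.
- move=> A totA; have [[t0 At0]|nA] := pselect (exists t, A t); last first.
    exists (exist B P (conj sP (fun x => lexx _))) => s As.
    by case: nA; exists s.
  pose S x := [set y | exists2 t : T, A t & y = sval t x]%classic.
  (* Uniform over the chain: [- P (- x) <= - t (- x) <= t x]. *)
  have lbS x : lbound (S x) (- P (- x)).
    move=> _ [t At ->]; have [st tP] := svalP t.
    by apply: le_trans (sublinearN x st); rewrite lerN2.
  have infle t x : A t -> inf (S x) <= sval t x.
    by move=> At; apply: ge_inf; [exists (- P (- x))|exists t].
  have leinf x c : (forall t, A t -> c <= sval t x) -> c <= inf (S x).
    move=> h; apply: lb_le_inf; first by exists (sval t0 x), t0.
    by move=> _ [t At ->]; exact: h.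
  have sI : sublinear (fun x => inf (S x)) /\ forall x, inf (S x) <= P x.
    split; last by move=> x; exact: le_trans (infle _ _ At0) ((svalP t0).2 x).
    split=> [x y|a x].
      (* Of two members of the chain, the smaller one can be used at both [x] and [y]. *)
      have h t : A t -> inf (S (x + y)) - sval t y <= inf (S x).
        move=> At; apply: leinf => s As; rewrite lerBlDr.
        have [/asboolP st|/asboolP ts] := totA _ _ As At.
          apply: le_trans (infle t _ At) _.
          by apply: le_trans ((svalP t).1.1 _ _) _; rewrite lerD2r.
        apply: le_trans (infle s _ As) _.
        by apply: le_trans ((svalP s).1.1 _ _) _; rewrite lerD2l.
      rewrite -lerBlDl; apply: leinf => t At; have := h _ At; lra.
    rewrite le0r => /orP[/eqP->|a0].
      rewrite scale0r mul0r; apply: le_trans (infle _ _ At0) _.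
      by rewrite (sublinear0 (svalP t0).1).
    rewrite -ler_pdivrMl//; apply: leinf => t At; rewrite ler_pdivrMl//.
    by apply: le_trans (infle _ _ At) _; apply: (svalP t).1.2; exact: ltW.
  by exists (exist B _ sI) => s As; apply/asboolP => x /=; exact: infle.
exists Q; split=> // Q' sQ' Q'Q x.
pose t : T := exist B Q' (conj sQ' (fun y => le_trans (Q'Q y) (QP y))).
have tQ : t = exist B Q (conj sQ QP) by apply: Qmin; apply/asboolP.
by have /= -> := congr1 sval tQ.
Qed.

(** A sandwich form: attainment at a point and extension along a map are obtained by choosing
    [K]. *)
Lemma hahn_banach P K : sublinear P -> convex_cone K ->
  (forall w c, K w c -> c <= P w) ->
  exists f, [/\ linear_form f, (forall x, f x <= P x) &
                forall w c, K w c -> c <= f w].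
Proof.
move=> sP cK KP.
have [f [sf fP fmin]] := exists_minimal_sublinear (conv_inf_sublinear sP cK KP).
have fD x y : f (x + y) = f x + f y.
  apply/eqP; rewrite eq_le sf.1/=.
  (* Imposing the value [f y] at [y] produces a sublinear functional below [f], hence [f] itself by
     minimality; this reads [f x <= f (x + y) - f y], the missing half of additivity. *)
  pose Ky w c := exists2 t : R, 0 <= t & w = t *: y /\ c = t * f y.
  have cKy : convex_cone Ky.
    split=> [|u v c d [s s0 [-> ->]] [t t0 [-> ->]]|a u c a0 [s s0 [-> ->]]].
    - by exists 0; rewrite // scale0r mul0r.
    - by exists (s + t); rewrite ?addr_ge0// scalerDl mulrDl.
    - by exists (a * s); rewrite ?mulr_ge0// scalerA mulrA.
  have KyP w c : Ky w c -> c <= f w.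
    move=> [t t0 [-> ->]]; have := sf.2; rewrite le0r in t0.
    case/orP: t0 => [/eqP->|t0] h; first by rewrite mul0r scale0r (sublinear0 sf).
    have := h t^-1 (t *: y); rewrite invr_ge0 (ltW t0) => /(_ erefl).
    by rewrite scalerA mulVf ?gt_eqF// scale1r ler_pdivlMl.
  have := fmin _ (conv_inf_sublinear sf cKy KyP) (conv_inf_leP sf cKy KyP) x.
  have Kyy : Ky y (f y) by exists 1; rewrite ?scale1r ?mul1r.
  have := conv_inf_le sf KyP x Kyy.
  lra.
have f0 := sublinear0 sf.
have fN x : f (- x) = - f x by have := fD x (- x); rewrite subrr f0; lra.
have fZ (a : R) x : 0 <= a -> f (a *: x) = a * f x.
  move=> a0; apply/eqP; rewrite eq_le sf.2//=.
  by have := sf.2 a (- x) a0; rewrite scalerN !fN mulrN lerN2.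
exists f; split.
- split=> // a x; have [a0|a0] := leP 0 a; first exact: fZ.
  by have := fZ (- a) x; rewrite scaleNr fN mulNr oppr_ge0 ltW// => /(_ erefl)/oppr_inj.
- by move=> x; apply: le_trans (fP x) (conv_inf_leP sP cK KP x).
- move=> w c Kwc; rewrite -lerN2 -fN.
  by apply: le_trans (fP _) (conv_infN sP KP Kwc).
Qed.

Lemma hahn_banach_attain P v : sublinear P ->
  exists f, [/\ linear_form f, (forall x, f x <= P x) & f v = P v].
Proof.
move=> sP.
have [||f [lf fP fK]] := @hahn_banach P
  (fun w c => exists2 t : R, 0 <= t & w = t *: v /\ c = t * P v) sP.
- split=> [|u w c d [s s0 [-> ->]] [t t0 [-> ->]]|a u c a0 [s s0 [-> ->]]].
  + by exists 0; rewrite // scale0r mul0r.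
  + by exists (s + t); rewrite ?addr_ge0// scalerDl mulrDl.
  + by exists (a * s); rewrite ?mulr_ge0// scalerA mulrA.
- move=> w c [t t0 [-> ->]]; move: t0; rewrite le0r.
  case/orP => [/eqP->|t0]; first by rewrite mul0r scale0r (sublinear0 sP).
  have := sP.2 t^-1 (t *: v); rewrite invr_ge0 (ltW t0) => /(_ erefl).
  by rewrite scalerA mulVf ?gt_eqF// scale1r ler_pdivlMl.
exists f; split=> //; apply/eqP; rewrite eq_le fP/=.
by apply: fK; exists 1; rewrite ?scale1r ?mul1r.
Qed.

End HahnBanach.

(** [K] is the graph of [lam] over [T]. It is stable under negation, so its lower constraints force
    equality. Domination makes [lam] vanish on the kernel of [T], so [lam] lives on the image. *)
Lemma hahn_banach_ext (R : realType) (V W : lmodType R) (T : W -> V)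
    (lam : W -> R) (P : V -> R) :
  sublinear P ->
  (forall x y, T (x + y) = T x + T y) -> (forall (a : R) x, T (a *: x) = a *: T x) ->
  linear_form lam -> (forall x, lam x <= P (T x)) ->
  exists f, [/\ linear_form f, (forall x, f x <= P x) & forall x, f (T x) = lam x].
Proof.
move=> sP TD TZ [lD lZ] lP.
have TN x : T (- x) = - T x by rewrite -scaleN1r TZ scaleN1r.
have lN x : lam (- x) = - lam x by rewrite -scaleN1r lZ mulN1r.
have [|w c [x -> ->]//|f [lf fP fK]] :=
  @hahn_banach R V P (fun w c => exists2 x, w = T x & c = lam x) sP.
  split=> [|u v c d [x -> ->] [y -> ->]|a u c a0 [x -> ->]].
  - by exists 0; [have := TZ 0 0; rewrite !scale0r|have := lZ 0 0; rewrite scale0r mul0r].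
  - by exists (x + y).
  - by exists (a *: x).
exists f; split=> // x; apply/eqP; rewrite eq_le fK ?andbT; last by exists x.
have fN y : f (- y) = - f y by rewrite -scaleN1r lf.2 mulN1r.
by rewrite -lerN2 -fN -TN -lN; apply: fK; exists (- x).
Qed.

(** * Banach lattices and positive forms *)

Section LatticeBasics.
Variables (R : realType) (X : BanachLattice R).
Implicit Types x y z : X.

Definition bpos x : X := bsup x 0.

Lemma ble_subr0 x y : ble x y <-> ble 0 (y - x).
Proof.
split=> [/(ble_add (- x))|/(ble_add x)]; first by rewrite subrr.
by rewrite add0r subrK.
Qed.

Lemma ble_addl x y z : ble x y -> ble (z + x) (z + y).
Proof. by rewrite ![z + _]addrC; exact: ble_add. Qed.

Lemma bleD x y z w : ble x y -> ble z w -> ble (x + z) (y + w).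
Proof. by move=> xy zw; apply: ble_trans (ble_add z xy) (ble_addl y zw). Qed.

Lemma ble_opp x y : ble x y -> ble (- y) (- x).
Proof. by move=> /ble_subr0 h; apply/ble_subr0; rewrite opprK addrC. Qed.

Lemma ble_addr0 x y : ble 0 x -> ble 0 y -> ble 0 (x + y).
Proof. by move=> x0 y0; rewrite -(addr0 0); exact: bleD. Qed.

Lemma ble_scale0 (a : R) x : 0 <= a -> ble 0 x -> ble 0 (a *: x).
Proof. by move=> a0 x0; have := ble_scale a0 x0; rewrite scaler0. Qed.

Lemma ble_scalel (a b : R) x : a <= b -> ble 0 x -> ble (a *: x) (b *: x).
Proof.
by move=> ab x0; apply/ble_subr0; rewrite -scalerBl; apply: ble_scale0; rewrite ?subr_ge0.
Qed.

Lemma bsupC x y : bsup x y = bsup y x.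
Proof. by apply: ble_anti; apply: bsup_least; (exact: bsup_ubr || exact: bsup_ubl). Qed.

Lemma bsup_idr x y : ble x y -> bsup x y = y.
Proof.
by move=> xy; apply: ble_anti; [apply: bsup_least => //; exact: ble_refl|exact: bsup_ubr].
Qed.

Lemma bsup_idl x y : ble y x -> bsup x y = x.
Proof. by move=> xy; rewrite bsupC bsup_idr. Qed.

Lemma bsup_add x y z : bsup (x + z) (y + z) = bsup x y + z.
Proof.
apply: ble_anti.
  by apply: bsup_least; apply: ble_add; [exact: bsup_ubl|exact: bsup_ubr].
rewrite -[X in ble _ X](subrK z); apply: ble_add.
by apply: bsup_least; rewrite -[X in ble X _](addrK z); apply: ble_add;
  [exact: bsup_ubl|exact: bsup_ubr].
Qed.

Lemma bsup_scale (a : R) x y : 0 <= a -> bsup (a *: x) (a *: y) = a *: bsup x y.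
Proof.
rewrite le0r => /orP[/eqP->|a0]; first by rewrite !scale0r bsup_idl//; exact: ble_refl.
have a0' := ltW a0; apply: ble_anti.
  by apply: bsup_least; apply: ble_scale => //; [exact: bsup_ubl|exact: bsup_ubr].
have aV z : z = a^-1 *: (a *: z) by rewrite scalerA mulVf ?gt_eqF// scale1r.
have aV' z : z = a *: (a^-1 *: z) by rewrite scalerA mulfV ?gt_eqF// scale1r.
rewrite [X in ble _ X]aV'; apply: ble_scale => //.
apply: bsup_least; rewrite [X in ble X _]aV; apply: ble_scale; rewrite ?invr_ge0//.
  exact: bsup_ubl.
exact: bsup_ubr.
Qed.

Lemma bpos_ge0 x : ble 0 (bpos x). Proof. exact: bsup_ubr. Qed.

Lemma ble_bpos x : ble x (bpos x). Proof. exact: bsup_ubl. Qed.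

Lemma bpos_least x y : ble x y -> ble 0 y -> ble (bpos x) y.
Proof. exact: bsup_least. Qed.

Lemma bpos_id x : ble 0 x -> bpos x = x. Proof. exact: bsup_idl. Qed.

Lemma bposN_id x : ble 0 x -> bpos (- x) = 0.
Proof. by move=> /ble_opp; rewrite oppr0; exact: bsup_idr. Qed.

Lemma bposB x : bpos x - bpos (- x) = x.
Proof.
rewrite /bpos; have := bsup_add x 0 (- x); rewrite subrr add0r (bsupC 0) => ->.
by rewrite opprB addrC subrK.
Qed.

Lemma bsupE x y : bsup x y = y + bpos (x - y).
Proof. by rewrite addrC -bsup_add subrK add0r. Qed.

Lemma bposD x y : ble (bpos (x + y)) (bpos x + bpos y).
Proof.
by apply: bpos_least; [apply: bleD; exact: ble_bpos|apply: ble_addr0; exact: bpos_ge0].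
Qed.

Lemma bpos_scale (a : R) x : 0 <= a -> bpos (a *: x) = a *: bpos x.
Proof. by move=> a0; rewrite /bpos -bsup_scale// scaler0. Qed.

Lemma babsE x : babs x = bpos x + bpos (- x).
Proof.
rewrite /babs bsupE opprK -mulr2n -scaler_nat bpos_scale ?ler0n// scaler_nat mulr2n.
by rewrite addrC -addrA; congr (_ + _); rewrite -{2}(bposB x) opprB addrC subrK.
Qed.

Lemma babs_ge0 x : ble 0 (babs x).
Proof. by rewrite babsE; apply: ble_addr0; exact: bpos_ge0. Qed.

Lemma babs_id x : ble 0 x -> babs x = x.
Proof. by move=> x0; rewrite babsE bpos_id// bposN_id// addr0. Qed.

Lemma bnorm_le x y : ble 0 x -> ble x y -> `|x| <= `|y|.
Proof.
move=> x0 xy; apply: babs_norm; rewrite -!/(babs _) !babs_id//.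
exact: ble_trans x0 xy.
Qed.

Lemma bnorm_abs x : `|babs x| = `|x|.
Proof.
have e : babs (babs x) = babs x by apply: babs_id; exact: babs_ge0.
apply/eqP; rewrite eq_le; apply/andP; split; apply: babs_norm.
  by change (ble (babs (babs x)) (babs x)); rewrite e; exact: ble_refl.
by change (ble (babs x) (babs (babs x))); rewrite e; exact: ble_refl.
Qed.

Lemma bnorm_bpos x : `|bpos x| <= `|x|.
Proof.
rewrite -(bnorm_abs x); apply: bnorm_le; first exact: bpos_ge0.
by rewrite babsE -{1}(addr0 (bpos x)); apply: ble_addl; exact: bpos_ge0.
Qed.

Lemma bnorm_pos_sublinear : sublinear (fun x => `|bpos x|).
Proof.
split=> [x y|a x a0].
  apply: le_trans (ler_normD _ _); apply: bnorm_le; first exact: bpos_ge0.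
  exact: bposD.
by rewrite bpos_scale// normrZ ger0_norm.
Qed.

Definition pos_form (f : X -> R) :=
  linear_form f /\ forall x, ble 0 x -> 0 <= f x.

(* On elements where it is exact, a positive form behaves as a lattice homomorphism. *)
Definition exact_on (f : X -> R) x := f (bpos x) = Num.max (f x) 0.

Section PosForm.
Variable f : X -> R.
Hypothesis pf : pos_form f.

Lemma pos_formD x y : f (x + y) = f x + f y. Proof. exact: pf.1.1. Qed.
Lemma pos_formZ (a : R) x : f (a *: x) = a * f x. Proof. exact: pf.1.2. Qed.
Lemma pos_formN x : f (- x) = - f x.
Proof. by rewrite -scaleN1r pos_formZ mulN1r. Qed.
Lemma pos_formB x y : f (x - y) = f x - f y.
Proof. by rewrite pos_formD pos_formN. Qed.
Lemma pos_form0 : f 0 = 0.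
Proof. by rewrite -(scale0r 0) pos_formZ mul0r. Qed.
Lemma pos_form_ge0 x : ble 0 x -> 0 <= f x. Proof. exact: pf.2. Qed.
Lemma pos_form_le x y : ble x y -> f x <= f y.
Proof. by move=> /ble_subr0/pos_form_ge0; rewrite pos_formB subr_ge0. Qed.
Lemma pos_form_sum (I : Type) (s : seq I) (F : I -> X) :
  f (\sum_(i <- s) F i) = \sum_(i <- s) f (F i).
Proof. exact: (big_morph f pos_formD pos_form0). Qed.

Lemma pos_form_bpos_sublinear : sublinear (fun x => f (bpos x)).
Proof.
split=> [x y|a x a0]; first by rewrite -pos_formD; apply: pos_form_le; exact: bposD.
by rewrite bpos_scale// pos_formZ.
Qed.

Lemma exact_on_babs x : exact_on f x -> f (babs x) = `|f x|.
Proof.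
rewrite /exact_on babsE pos_formD => e.
have := congr1 f (bposB x); rewrite pos_formB e.
by have [h|h] := leP 0 (f x); [rewrite ger0_norm//|rewrite ltr0_norm//]; lra.
Qed.

Lemma exact_on_bsup x y : exact_on f (x - y) -> f (bsup x y) = Num.max (f x) (f y).
Proof.
rewrite /exact_on bsupE !pos_formD pos_formN => ->.
by have [h|h] := leP 0 (f x - f y); have [h'|h'] := leP (f x) (f y); lra.
Qed.

Lemma abs_pos_form x : `|f x| <= f (babs x).
Proof.
rewrite babsE pos_formD -{1}(bposB x) pos_formB.
have := pos_form_ge0 (bpos_ge0 x); have := pos_form_ge0 (bpos_ge0 (- x)).
by move=> h1 h2; rewrite ler_norml; apply/andP; split; lra.
Qed.

End PosForm.

(** Exactness of a positive form at [x] means that it vanishes on [x^+] or on [x^-], and this passes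
    to smaller positive forms. *)
Lemma exact_on_le (f g : X -> R) x : pos_form f -> pos_form g ->
  (forall y, ble 0 y -> g y <= f y) -> exact_on f x -> exact_on g x.
Proof.
move=> pf pg gf; rewrite /exact_on => e.
have f1 := congr1 f (bposB x); have g1 := congr1 g (bposB x).
rewrite !(pos_formB pf) e in f1; rewrite (pos_formB pg) in g1.
have := gf _ (bpos_ge0 x); have := gf _ (bpos_ge0 (- x)); rewrite e.
have := pos_form_ge0 pg (bpos_ge0 x); have := pos_form_ge0 pg (bpos_ge0 (- x)).
move: f1; have [h|h] := leP 0 (f x); have [h'|h'] := leP 0 (g x); lra.
Qed.

(** A bound through the positive part is what makes Hahn-Banach produce positive forms: at [- x]
    with [x >= 0] it is [N 0 = 0]. *)
Lemma le_bpos_pos_form (f : X -> R) (N : X -> R) : linear_form f ->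
  N 0 = 0 -> (forall x, f x <= N (bpos x)) -> pos_form f.
Proof.
move=> lf N0 fN; split=> // x x0; have := fN (- x).
by rewrite bposN_id// N0 -scaleN1r lf.2 mulN1r oppr_le0.
Qed.

Lemma pos_form_sub (f g : X -> R) : pos_form f -> pos_form g ->
  (forall y, ble 0 y -> g y <= f y) -> pos_form (fun y => f y - g y).
Proof.
move=> pf pg gf; split; last by move=> y /gf; rewrite subr_ge0.
split=> [y z|a y]; first by rewrite (pos_formD pf) (pos_formD pg); ring.
by rewrite (pos_formZ pf) (pos_formZ pg); ring.
Qed.

(** [g] is the part of [f] carried by [x^+]: from [g x = f (x^+)] and [g <= f] follow [g (x^-) = 0]
    and [g (x^+) = f (x^+)], so the remainder vanishes on [x^+]. *)
Lemma pos_form_split (f : X -> R) x : pos_form f ->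
  exists g h, [/\ pos_form g, pos_form h, (forall y, f y = g y + h y),
    exact_on g x & exact_on h x].
Proof.
move=> pf; have [g [lg gf gx]] := hahn_banach_attain x (pos_form_bpos_sublinear pf).
have pg : pos_form g := le_bpos_pos_form lg (pos_form0 pf) gf.
have ge y : ble 0 y -> g y <= f y by move=> y0; have := gf y; rewrite bpos_id.
exists g, (fun y => f y - g y); split=> //.
- exact: pos_form_sub.
- by move=> y; rewrite addrC subrK.
- rewrite /exact_on; have := ge _ (bpos_ge0 x).
  have := pos_form_ge0 pg (bpos_ge0 x); have := pos_form_ge0 pg (bpos_ge0 (- x)).
  have := congr1 g (bposB x); rewrite (pos_formB pg).
  by have [h|h] := leP 0 (g x); lra.
- rewrite /exact_on; have := ge _ (bpos_ge0 x); have := ge _ (bpos_ge0 (- x)).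
  have := pos_form_ge0 pg (bpos_ge0 (- x)).
  have := congr1 g (bposB x); have := congr1 f (bposB x).
  rewrite (pos_formB pg) (pos_formB pf).
  by have [h|h] := leP 0 (f x - g x); lra.
Qed.

Lemma norming_pos_form x : exists f : X -> R,
  [/\ pos_form f, (forall y, f y <= `|y|) & f x = `|bpos x|].
Proof.
have [f [lf fP fx]] := hahn_banach_attain x bnorm_pos_sublinear.
exists f; split=> //; first exact: (le_bpos_pos_form lf (normr0 _) fP).
by move=> y; apply: le_trans (fP y) (bnorm_bpos y).
Qed.

(* Any positive form is a finite sum of positive forms exact on a given finite list, so an
   inequality between lattice polynomials need only be tested on forms exact on the
   polynomials involved, i.e. on real numbers. *)
Lemma exact_form_le (L : seq X) (a b : X) (f : X -> R) : pos_form f ->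
  (forall g, pos_form g -> (forall y, ble 0 y -> g y <= f y) ->
     (forall x, List.In x L -> exact_on g x) -> g a <= g b) -> f a <= f b.
Proof.
elim: L f => [|x L IH] f pf h.
  by apply: h => // y _; exact: lexx.
have [g [k [pg pk e gx kx]]] := pos_form_split x pf.
have gf y : ble 0 y -> g y <= f y.
  by move=> y0; rewrite e lerDl; exact: pos_form_ge0.
have kf y : ble 0 y -> k y <= f y.
  by move=> y0; rewrite e lerDr; exact: pos_form_ge0.
rewrite !e; apply: lerD; apply: IH => // g' pg' g'g g'L; apply: h => //.
- by move=> y y0; apply: le_trans (g'g y y0) (gf y y0).
- by move=> y [<-|/g'L//]; exact: exact_on_le pg pg' g'g gx.
- by move=> y y0; apply: le_trans (g'g y y0) (kf y y0).
- by move=> y [<-|/g'L//]; exact: exact_on_le pk pg' g'g kx.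
Qed.

Lemma ble_pos_form (a b : X) : (forall f, pos_form f -> f a <= f b) -> ble a b.
Proof.
move=> h; have [f [pf _ fE]] := norming_pos_form (a - b).
have : `|bpos (a - b)| <= 0 by rewrite -fE (pos_formB pf) subr_le0; exact: h.
rewrite normr_le0 => /eqP e; apply/ble_subr0.
by have := ble_opp (ble_bpos (a - b)); rewrite e oppr0 opprB.
Qed.

Lemma ble_exact_form (L : seq X) (a b : X) :
  (forall g, pos_form g -> (forall x, List.In x L -> exact_on g x) -> g a <= g b) ->
  ble a b.
Proof.
by move=> h; apply: ble_pos_form => f pf; apply: (@exact_form_le L) => // g pg _; exact: h.
Qed.

End LatticeBasics.

(** * Real inequalities *)

Section RealInequalities.
Variables (R : realType) (p q : R).
Hypotheses (p_gt1 : 1 < p) (qE : q = p / (p - 1)).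

Lemma conj_exp_gt1 : 1 < q.
Proof. by move: p_gt1 => h; rewrite qE ltr_pdivlMr; lra. Qed.

Lemma conj_expV : p^-1 + q^-1 = 1.
Proof. by move: p_gt1 => h; rewrite qE; field; apply/andP; split; apply/eqP; lra. Qed.

Let p0 : 0 < p. Proof. by move: p_gt1; lra. Qed.
Let q0 : 0 < q. Proof. by have := conj_exp_gt1; lra. Qed.

Lemma powR_le (a b r : R) : 0 <= r -> 0 <= a -> a <= b -> a `^ r <= b `^ r.
Proof.
by move=> r0 a0 ab; apply: ge0_ler_powR; rewrite ?nnegrE//; exact: le_trans a0 ab.
Qed.

Lemma powRK (a r : R) : 0 <= a -> 0 < r -> (a `^ r^-1) `^ r = a.
Proof. by move=> a0 r0; rewrite -powRrM mulVf ?gt_eqF// powRr1. Qed.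

Lemma powRVK (a r : R) : 0 <= a -> 0 < r -> (a `^ r) `^ r^-1 = a.
Proof. by move=> a0 r0; rewrite -powRrM mulfV ?gt_eqF// powRr1. Qed.

Lemma hoelder_seq (I : Type) (s : seq I) (x y : I -> R) :
  (forall i, 0 <= x i) -> (forall i, 0 <= y i) ->
  \sum_(i <- s) x i * y i <=
  (\sum_(i <- s) x i `^ p) `^ p^-1 * (\sum_(i <- s) y i `^ q) `^ q^-1.
Proof.
move=> x0 y0; elim: s => [|i s IH].
  by rewrite !big_nil mulr_ge0// powR_ge0.
have X0 : 0 <= \sum_(j <- s) x j `^ p by apply: sumr_ge0 => j _; exact: powR_ge0.
have Y0 : 0 <= \sum_(j <- s) y j `^ q by apply: sumr_ge0 => j _; exact: powR_ge0.
rewrite !big_cons; apply: le_trans (lerD (lexx _) IH) _.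
move: (\sum_(j <- s) x j `^ p) (\sum_(j <- s) y j `^ q) X0 Y0 => X Y X0 Y0.
have := hoelder2 (x0 i) (powR_ge0 X p^-1) (y0 i) (powR_ge0 Y q^-1) p0 q0 conj_expV.
by rewrite (powRK X0 p0) (powRK Y0 q0).
Qed.

(** Bernoulli's inequality, read off from Young's inequality with second factor [1]. *)
Lemma powR_add1_le (t : R) : 0 <= t -> (1 + t) `^ p^-1 <= 1 + t / p.
Proof.
move=> t0; have := @conjugate_powR R ((1 + t) `^ p^-1) 1 p q (powR_ge0 _ _) ler01 p0 q0 conj_expV.
rewrite mulr1 powRK ?addr_ge0// powR1 => /le_trans; apply.
by have := conj_expV; rewrite mulrDl !mul1r; lra.
Qed.

(** Bernoulli bounds [(1 - u)^(1/p)], and its product with [(1 - u)^(1/q)] is [1 - u]. Both sides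
    are [u / q] to first order, which is the precision needed by [exists_weights]. *)
Lemma powR_sub1_ge (u : R) : 0 <= u -> u < 1 ->
  1 - (1 - u) `^ q^-1 <= u / q / (1 - u).
Proof.
move=> u0 u1; have w0 : 0 < 1 - u by lra.
have h : (1 - u) `^ p^-1 <= 1 - u / p.
  have := @conjugate_powR R ((1 - u) `^ p^-1) 1 p q (powR_ge0 _ _) ler01 p0 q0 conj_expV.
  rewrite mulr1 powRK ?(ltW w0)// powR1 => /le_trans; apply.
  by have := conj_expV; rewrite mulrBl !mul1r; lra.
have e : (1 - u) `^ q^-1 * (1 - u) `^ p^-1 = 1 - u.
  by rewrite -powRD ?(gt_eqF w0) ?implybT// [q^-1 + _]addrC conj_expV powRr1// ltW.
have up : u / p <= u by rewrite ler_pdivrMr//; move: p_gt1; nra.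
have k : 1 - u <= (1 - u) `^ q^-1 * (1 - u / p).
  by rewrite -{1}e; apply: ler_wpM2l => //; exact: powR_ge0.
have eq : u / q = u - u / p by have := conj_expV; rewrite -{2}(mulr1 u) => <-; ring.
rewrite ler_pdivlMr// eq.
have a1 : (1 - u) `^ q^-1 <= 1.
  have := @powR_le (1 - u) 1 q^-1; rewrite powR1; apply; rewrite ?invr_ge0 ?(ltW q0)//; lra.
nra.
Qed.

(* Optimising [t] in Young's inequality. *)
Lemma le_of_young (A B : R) : 0 <= B ->
  (forall t, 0 < t -> t * A <= B / q + t `^ p / p) -> A <= B `^ q^-1.
Proof.
rewrite le0r => /orP[/eqP->|B0] h.
  rewrite powR0 ?invr_neq0 ?gt_eqF// leNgt; apply/negP => A0.
  (* For [B = 0] the assumption is [A <= t^(p-1) / p]; this [t] makes the right side [A / 2]. *)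
  have [t t0 tE] : exists2 t, 0 < t & t `^ (p - 1) = A * p / 2.
    exists ((A * p / 2) `^ (p - 1)^-1); first by rewrite powR_gt0// !mulr_gt0.
    by rewrite powRK ?subr_gt0// !mulr_ge0 ?ltW.
  have := h _ t0; rewrite mul0r add0r -mulr_powRB1 ?(ltW t0)// tE.
  have -> : t * (A * p / 2) / p = t * (A / 2) by field; rewrite gt_eqF.
  by rewrite ler_pM2l//; lra.
(* At [t = B^(1/p)] the right side equals [B], and [B / t = B^(1/q)]. *)
have t0 : 0 < B `^ p^-1 by rewrite powR_gt0.
have := h _ t0; rewrite powRK ?(ltW B0)// -mulrDr [q^-1 + _]addrC conj_expV mulr1.
rewrite -ler_pdivlMl// => /le_trans; apply.
rewrite -powRN -{2}(powRr1 (ltW B0)) -powRD ?(gt_eqF B0) ?implybT//.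
by have -> : - p^-1 + 1 = q^-1 by have := conj_expV; lra.
Qed.

End RealInequalities.

(** * Upper p-estimates *)

Section UpperPEstimate.
Variables (R : realType) (p : R) (X : BanachLattice R).
Hypotheses (p_gt1 : 1 < p) (XC : in_Cpinf p X).

Let p0 : 0 < p. Proof. by move: p_gt1; lra. Qed.

Lemma upper_estimate2 (u v : X) : ble 0 u -> ble 0 v -> binf u v = 0 ->
  `|u + v| <= (`|u| `^ p + `|v| `^ p) `^ p^-1.
Proof.
move=> u0 v0 uv; pose w (i : 'I_2) := if i == ord0 then u else v.
have := XC (x := w); rewrite !big_ord_recl !big_ord0 !addr0; apply.
have vu : binf v u = 0 by rewrite /binf bsupC.
rewrite /w => i j; case: i => [[|[|//]] ?]; case: j => [[|[|//]] ?] //= _; rewrite !babs_id//.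
Qed.

Section Pieces.
Variables (x y : X) (N : R) (k : nat).
Hypotheses (x0 : ble 0 x) (y0 : ble 0 y) (N0 : 0 < N).

Let theta (j : nat) : R := 1 + j%:R / N.
Let e (j : nat) : X := bpos (x - theta j *: y).
(** Band projections may fail to exist; [N *: (e k.+1 - e k.+2)] is a continuous substitute for [y]
    cut down to [x > theta k.+1 *: y]. So [u] imitates [x] above the cut and [v] imitates [y] below
    it. The index shift in [v] makes them exactly disjoint. *)
Let u := e k.+1 + (theta k.+1 * N) *: (e k.+1 - e k.+2).
Let v := y + N *: (e k.+1 - e k).

Let pieces (g : X -> R) : pos_form g ->
  exact_on g (x - theta k *: y) -> exact_on g (x - theta k.+1 *: y) ->
  exact_on g (x - theta k.+2 *: y) ->
  [/\ 0 <= g u, g u <= g x, 0 <= g v, g v <= g y & g u = 0 \/ g v = 0].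
Proof.
move=> pg E0 E1 E2.
have a0 := pos_form_ge0 pg x0; have b0 := pos_form_ge0 pg y0.
move: E0 E1 E2; rewrite /exact_on !(pos_formB pg, pos_formZ pg).
rewrite /u /v !(pos_formD pg, pos_formZ pg, pos_formN pg) -/(e k) -/(e k.+1) -/(e k.+2).
move: (g (e k)) (g (e k.+1)) (g (e k.+2)) => e0 e1 e2.
move: (g x) (g y) a0 b0 => a b a0 b0.
pose beta := b / N; have beta0 : 0 <= beta by rewrite divr_ge0// ltW.
have bE : b = N * beta by rewrite mulrC divfK ?gt_eqF.
pose t := theta k.+1.
have t0 : 0 <= t by rewrite addr_ge0// divr_ge0// ltW.
have -> : theta k * b = t * b - beta.
  by rewrite /t /theta /beta -[k.+1%:R]natr1; field; rewrite gt_eqF.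
have -> : theta k.+2 * b = t * b + beta.
  by rewrite /t /theta /beta -[k.+2%:R]natr1; field; rewrite gt_eqF.
rewrite -/t; set c := t * b; have cE : c = t * N * beta by rewrite /c bE mulrA.
have tN0 : 0 <= t * N by rewrite mulr_ge0// ltW.
have c0 : 0 <= c by rewrite mulr_ge0.
(* Below the cut [e1] and [e2] vanish and [u] is [0]; above it [e0 - e1 = b / N] and [v] is [0]. *)
have [h|h] := leP (a - c) 0.
- have -> : Num.max (a - (c + beta)) 0 = 0 by apply/max_idPr; lra.
  move=> e0E -> ->; have e0b : e0 <= beta by rewrite e0E ge_max; apply/andP; split; lra.
  have e00 : 0 <= e0 by rewrite e0E le_max lexx orbT.
  have k1 : N * e0 <= N * beta by rewrite ler_wpM2l// ltW.
  have k2 : 0 <= N * e0 by rewrite mulr_ge0// ltW.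
  by split; rewrite ?bE ?sub0r ?oppr0 ?mulrN ?mulr0 ?addr0; [lra..|left].
- have -> : Num.max (a - (c - beta)) 0 = a - (c - beta) by apply/max_idPl; lra.
  move=> -> -> e2E.
  have e2a : a - c - beta <= e2 by rewrite e2E le_max; apply/orP; left; lra.
  have e2b : e2 <= a - c by rewrite e2E ge_max; apply/andP; split; lra.
  have k1 : t * N * (a - c - e2) <= c by rewrite cE ler_wpM2l//; lra.
  have k2 : 0 <= t * N * (a - c - e2) by rewrite mulr_ge0//; lra.
  have vE : b + N * (a - c - (a - (c - beta))) = 0 by rewrite bE; ring.
  by split; rewrite ?vE; [lra..|right].
Qed.

Let L := [:: x - theta k *: y; x - theta k.+1 *: y; x - theta k.+2 *: y].

Let piecesL (g : X -> R) : pos_form g -> (forall z, List.In z L -> exact_on g z) ->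
  [/\ 0 <= g u, g u <= g x, 0 <= g v, g v <= g y & g u = 0 \/ g v = 0].
Proof. by move=> pg gL; apply: pieces => //; apply: gL; rewrite /L/=; tauto. Qed.

Lemma norm_pieces : `|u + v| <= (`|x| `^ p + `|y| `^ p) `^ p^-1.
Proof.
have u0 : ble 0 u.
  by apply: (@ble_exact_form _ _ L) => g pg gL; rewrite (pos_form0 pg); case: (piecesL pg gL).
have v0 : ble 0 v.
  by apply: (@ble_exact_form _ _ L) => g pg gL; rewrite (pos_form0 pg); case: (piecesL pg gL).
have ux : ble u x by apply: (@ble_exact_form _ _ L) => g pg gL; case: (piecesL pg gL).
have vy : ble v y by apply: (@ble_exact_form _ _ L) => g pg gL; case: (piecesL pg gL).
have uv : binf u v = 0.
  apply: ble_anti; last first.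
    rewrite /binf -[X in ble X _]oppr0; apply: ble_opp; apply: bsup_least;
    by rewrite -[X in ble _ X]oppr0; apply: ble_opp.
  apply: (@ble_exact_form _ _ ((- u - - v) :: L)) => g pg gL.
  have [gu0 _ gv0 _ uv] := piecesL pg (fun z zL => gL z (or_intror zL)).
  rewrite /binf (pos_formN pg) (exact_on_bsup pg) ?(pos_form0 pg); last by apply: gL; left.
  rewrite !(pos_formN pg) oppr_le0 le_max !oppr_ge0.
  by case: uv => ->; rewrite lexx ?orbT.
apply: le_trans (upper_estimate2 u0 v0 uv) _.
apply: powR_le; rewrite ?invr_ge0 ?(ltW p0) ?addr_ge0 ?powR_ge0//.
by apply: lerD; apply: powR_le; rewrite ?(ltW p0)//; apply: bnorm_le.
Qed.

End Pieces.

(* The norm of [x \/ y] is attained by a positive form [f].  Cutting along [x = theta y]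
   loses the mass of a neighbourhood of the cut; as [theta] runs through [M] values the
   losses are second differences of [theta |-> f (x - theta y)^+] and telescope. *)
Lemma norm_bsup_upper_estimate (x y : X) : ble 0 x -> ble 0 y ->
  `|bsup x y| <= (`|x| `^ p + `|y| `^ p) `^ p^-1.
Proof.
move=> x0 y0; have [f [pf f1 fE]] := norming_pos_form (bsup x y).
rewrite bpos_id in fE; last exact: ble_trans x0 (bsup_ubl _ _).
set B := _ `^ p^-1; rewrite -fE.
have fy0 := pos_form_ge0 pf y0.
suff h (M : nat) : (0 < M)%N -> M%:R * (f (bsup x y) - B) <= 2 * f y.
  rewrite leNgt; apply/negP => lt.
  have d0 : 0 < f (bsup x y) - B by rewrite subr_gt0.
  have /archi_boundP : 0 <= 2 * f y / (f (bsup x y) - B) by rewrite divr_ge0 ?mulr_ge0// ltW.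
  set n := Num.Def.archi_bound _; rewrite ltr_pdivrMr// => nlt.
  have := h n.+1 erefl; rewrite -natr1 mulrDl; lra.
move=> M0; have MR : 0 < M%:R :> R by rewrite ltr0n.
(* With [M] cuts at spacing [1 / M^2], the levels exceed [1] by at most [1 / M], costing [f y / M]
   per cut; the telescoped differences times [N] cost at most another [f y] in all. Hence the bound
   [2 * f y]. *)
pose N : R := M%:R * M%:R; have N0 : 0 < N by rewrite mulr_gt0.
pose theta (j : nat) : R := 1 + j%:R / N.
pose F j := f (bpos (x - theta j *: y)).
have thD j : theta j.+1 = theta j + N^-1 by rewrite /theta -natr1 mulrDl mul1r addrA.
have F_dec j : F j.+1 <= F j.
  apply: pos_form_le => //; apply: bpos_least; last exact: bpos_ge0.
  apply: ble_trans (ble_bpos _); apply: ble_addl; apply: ble_opp.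
  by apply: ble_scalel => //; rewrite thD lerDl invr_ge0 ltW.
have F_lip j : F j <= F j.+1 + N^-1 * f y.
  rewrite -(pos_formZ pf) -(pos_formD pf); apply: pos_form_le => //.
  have Ny : ble 0 (N^-1 *: y) by apply: ble_scale0 => //; rewrite invr_ge0 ltW.
  apply: bpos_least; last by apply: ble_addr0 => //; exact: bpos_ge0.
  have -> : x - theta j *: y = x - theta j.+1 *: y + N^-1 *: y.
    by rewrite thD (scalerDl y (theta j)) opprD addrA subrK.
  by apply: ble_add; exact: ble_bpos.
have F0 : f (bsup x y) = f y + F 0%N.
  by rewrite bsupE (pos_formD pf) /F /theta mul0r addr0 scale1r.
have Flip j : F 0%N <= F j + j%:R / N * f y.
  elim: j => [|j IH]; first by rewrite mul0r mul0r addr0.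
  apply: le_trans IH _; have := F_lip j; rewrite -natr1; lra.
have step j : (j < M)%N -> f (bsup x y) - B <=
    M%:R^-1 * f y + N * ((F j - F j.+1) - (F j.+1 - F j.+2)).
  move=> jM; have /= nb := norm_pieces j x0 y0 N0.
  have := le_trans (f1 _) nb; rewrite -/B.
  rewrite !(pos_formD pf, pos_formZ pf, pos_formN pf) -/(theta _) -!/(F _).
  have th1 : 1 <= theta j.+1 by rewrite lerDl divr_ge0// ltW.
  have D0 : 0 <= N * (F j.+1 - F j.+2) by rewrite mulr_ge0 ?subr_ge0// ltW.
  have : N * (F j.+1 - F j.+2) <= theta j.+1 * N * (F j.+1 - F j.+2).
    by rewrite -mulrA ler_peMl.
  have := Flip j.+1; rewrite F0.
  have : j.+1%:R / N * f y <= M%:R^-1 * f y.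
    apply: ler_wpM2r => //; rewrite ler_pdivrMr// /N mulrA mulVf ?gt_eqF// mul1r.
    by rewrite ler_nat.
  lra.
have : M%:R * (f (bsup x y) - B) <=
       \sum_(j < M) (M%:R^-1 * f y + N * ((F j - F j.+1) - (F j.+1 - F j.+2))).
  by rewrite mulr_natl -{1}(card_ord M) -sumr_const; apply: ler_sum => j _; exact: step.
move=> /le_trans; apply.
rewrite big_split/= sumr_const card_ord -mulr_sumr.
rewrite -[X in X + _ <= _]mulr_natl mulrA mulfV ?gt_eqF// mul1r.
have -> : \sum_(j < M) ((F j - F j.+1) - (F j.+1 - F j.+2)) =
    (F 0%N - F 1%N) - (F M - F M.+1).
  elim: (M) => [|m IH]; first by rewrite big_ord0 subrr.
  by rewrite big_ord_recr/= IH; ring.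
have : N * ((F 0%N - F 1%N) - (F M - F M.+1)) <= N * (N^-1 * f y).
  apply: ler_wpM2l; first exact: ltW.
  have := F_lip 0%N; have := F_dec M; lra.
rewrite mulrA mulfV ?gt_eqF// mul1r; lra.
Qed.

(** [z] is the supremum of the [x i] and [0], and the binary estimate iterates. The coefficients
    that keep a combination below [z] are those of the [l_1] ball. *)
Lemma upper_estimate_majorant (I : Type) (s : seq I) (x : I -> X) :
  (forall i, ble 0 (x i)) ->
  exists z : X, [/\ ble 0 z, `|z| <= (\sum_(i <- s) `|x i| `^ p) `^ p^-1 &
    forall a : I -> R, (forall i, 0 <= a i) ->
      ble (\sum_(i <- s) a i *: x i) ((\sum_(i <- s) a i) *: z)].
Proof.
move=> x0; elim: s => [|i s [z [z0 nz za]]].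
  exists 0; split; first exact: ble_refl.
    by rewrite normr0 powR_ge0.
  by move=> a _; rewrite !big_nil scaler0; exact: ble_refl.
have xz : ble (x i) (bsup (x i) z) by exact: bsup_ubl.
exists (bsup (x i) z); split; first exact: ble_trans (x0 i) xz.
  apply: le_trans (norm_bsup_upper_estimate (x0 i) z0) _.
  rewrite big_cons; apply: powR_le; rewrite ?invr_ge0 ?(ltW p0) ?addr_ge0 ?powR_ge0//.
  rewrite lerD2l -[leRHS](powRK (r := p)) //; last first.
    by apply: sumr_ge0 => j _; exact: powR_ge0.
  by apply: powR_le; rewrite ?(ltW p0).
move=> a a0; rewrite !big_cons scalerDl; apply: bleD; first exact: ble_scale.
apply: ble_trans (za _ a0) _; apply: ble_scale; last exact: bsup_ubr.
exact: sumr_ge0.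
Qed.

End UpperPEstimate.

(** * p-convexity *)

Section PConvex.
Variables (R : realType) (p q : R) (X : BanachLattice R).
Hypotheses (p_gt1 : 1 < p) (qE : q = p / (p - 1)).

Let q0 : 0 < q. Proof. by have := conj_exp_gt1 p_gt1 qE; lra. Qed.

(** The order is closed in norm: [a - b <= d] bounds the norm of [(a - b)^+] by that of [d]. *)
Lemma ble_approx (a b : X) :
  (forall eps : R, 0 < eps -> exists2 d : X, `|d| <= eps & ble a (b + d)) -> ble a b.
Proof.
move=> h; suff /eqP/normr0_eq0 e : `|bpos (a - b)| == 0.
  apply/ble_subr0; have := ble_opp (ble_bpos (a - b)).
  by rewrite e oppr0 opprB.
rewrite eq_le normr_ge0 andbT; apply/ler_addgt0Pl => eps e0.
have [d de abd] := h _ e0; rewrite addr0; apply: le_trans de.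
apply: le_trans (bnorm_bpos d); apply: bnorm_le; first exact: bpos_ge0.
apply: bpos_least; last exact: bpos_ge0.
apply: ble_trans (ble_bpos d).
by have := ble_add (- b) abd; rewrite addrAC subrr add0r.
Qed.

Lemma ble_sum (I : Type) (s : seq I) (F G : I -> X) :
  (forall i, ble (F i) (G i)) -> ble (\sum_(i <- s) F i) (\sum_(i <- s) G i).
Proof.
move=> h; elim: s => [|i s IH]; first by rewrite !big_nil; exact: ble_refl.
by rewrite !big_cons; apply: bleD.
Qed.

Lemma ble_bigsup (I : finType) (P : pred I) (F : I -> X) i :
  P i -> ble (F i) (\big[@bsup R X/0]_(j | P j) F j).
Proof.
move=> Pi; rewrite -big_filter; have : i \in seq.filter P (index_enum I).
  by rewrite mem_filter Pi mem_index_enum.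
elim: (seq.filter _ _) => // j s IH; rewrite inE big_cons => /orP[/eqP<-|/IH h].
  exact: bsup_ubl.
exact: ble_trans h (bsup_ubr _ _).
Qed.

Lemma bigsup_ble (I : finType) (P : pred I) (F : I -> X) z :
  ble 0 z -> (forall i, P i -> ble (F i) z) -> ble (\big[@bsup R X/0]_(j | P j) F j) z.
Proof. by move=> z0 h; elim/big_ind: _ => // u v; exact: bsup_least. Qed.

Variables (n : nat) (x : 'I_n -> X).
Hypothesis x0 : forall i, ble 0 (x i).

(** Mesh [1 / (m + 1)] on [[0, 1]] with both ends, hence [m + 2] values. The supremum defining
    [z_ m] is finite and so exists in any lattice; the full [l_q] ball would require an infinite
    one. *)
Let grid m := {ffun 'I_n -> 'I_m.+2}.
Let coord m (j : grid m) k : R := (j k : nat)%:R / m.+1%:R.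
Let ball m (j : grid m) := \sum_(k < n) coord j k `^ q <= 1.
Let z_ m : X := \big[@bsup R X/0]_(j : grid m | ball j) \sum_(k < n) coord j k *: x k.
Let S := \sum_(k < n) x k.

(** Rounding each [|a k|] down to the grid stays in the ball and loses at most one mesh per
    coordinate. *)
Let grid_upper m (a : 'I_n -> R) : \sum_(k < n) `|a k| `^ q <= 1 ->
  ble (\sum_(k < n) a k *: x k) (z_ m + m.+1%:R^-1 *: S).
Proof.
move=> a1; have m0 : 0 < m.+1%:R :> R by rewrite ltr0n.
have ak1 k : `|a k| <= 1.
  rewrite leNgt; apply/negP => lt1.
  have : `|a k| `^ q <= 1.
    apply: le_trans a1; rewrite (bigD1 k)//= lerDl.
    by apply: sumr_ge0 => i _; exact: powR_ge0.
  apply/negP; rewrite -ltNge.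
  have := @gt0_ltr_powR R q q0 1 `|a k|; rewrite powR1; apply => //; rewrite nnegrE//.
pose t k := Num.trunc (m.+1%:R * `|a k|).
have tk k : (t k < m.+2)%N.
  have /andP[t1 _] := truncn_itv (mulr_ge0 (ltW m0) (normr_ge0 (a k))).
  rewrite ltnS -(ler_nat R); apply: le_trans t1 _.
  by rewrite -[leRHS]mulr1; apply: ler_wpM2l => //; exact: ltW.
pose j : grid m := [ffun k => Ordinal (tk k)].
have jE k : coord j k = (t k)%:R / m.+1%:R by rewrite /coord ffunE.
have ja k : coord j k <= `|a k|.
  have /andP[t1 _] := truncn_itv (mulr_ge0 (ltW m0) (normr_ge0 (a k))).
  by rewrite jE ler_pdivrMr// mulrC.
have aj k : `|a k| <= coord j k + m.+1%:R^-1.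
  have /andP[_ t1] := truncn_itv (mulr_ge0 (ltW m0) (normr_ge0 (a k))).
  rewrite jE -{2}[m.+1%:R^-1]mul1r -mulrDl natr1 ler_pdivlMr// mulrC; exact: ltW.
have jb : ball j.
  apply: le_trans a1; apply: ler_sum => k _; apply: powR_le => //; first exact: ltW.
  by rewrite jE divr_ge0// ltW.
have := ble_bigsup (fun j : grid m => \sum_(k < n) coord j k *: x k) jb.
move=> /(ble_add (m.+1%:R^-1 *: S)); apply: ble_trans.
rewrite /S scaler_sumr -big_split/=; apply: ble_sum => k; rewrite -scalerDl.
by apply: ble_scalel => //; apply: le_trans (ler_norm _) (aj k).
Qed.

Let S0 : ble 0 S.
Proof. by rewrite /S; elim/big_ind: _ => //; [exact: ble_refl|exact: ble_addr0]. Qed.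

Let coord_ge0 m (j : grid m) k : 0 <= coord j k.
Proof. by rewrite divr_ge0. Qed.

Let z_le m (w : X) : (forall a : 'I_n -> R, \sum_(k < n) `|a k| `^ q <= 1 ->
  ble (\sum_(k < n) a k *: x k) w) -> ble (z_ m) w.
Proof.
move=> h; apply: bigsup_ble => [|j jb].
  have := h (fun=> 0); rewrite big1 => [|i _]; last by rewrite normr0 powR0// gt_eqF.
  by rewrite big1 => [|i _]; [apply|rewrite scale0r].
by apply: h; rewrite (eq_bigr (fun k => coord j k `^ q))// => k _; rewrite ger0_norm.
Qed.

Let z_dist m m' : `|z_ m - z_ m'| <= (m.+1%:R^-1 + m'.+1%:R^-1) * `|S|.
Proof.
have i0 k : 0 <= k.+1%:R^-1 :> R by rewrite invr_ge0.
rewrite -[X in X * _]ger0_norm ?addr_ge0// -normrZ.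
set W := _ *: S; have W0 : ble 0 W by apply: ble_scale0; rewrite ?addr_ge0.
apply: babs_norm; rewrite -/(babs W) babs_id//.
have h k k' : ble (z_ k - z_ k') ((k.+1%:R^-1 + k'.+1%:R^-1) *: S).
  have : ble (z_ k) (z_ k' + k'.+1%:R^-1 *: S).
    by apply: z_le => a a1; exact: grid_upper.
  move=> /(ble_add (- z_ k')); rewrite addrAC subrr add0r => /ble_trans; apply.
  by apply: ble_scalel => //; rewrite lerDr.
apply: bsup_least; first exact: h.
by rewrite opprB /W [_^-1 + _]addrC; exact: h.
Qed.

Let z_lim : exists z : X, forall eps : R, 0 < eps ->
  exists2 m, `|z - z_ m| <= eps & m.+1%:R^-1 <= eps.
Proof.
have small (eps : R) : 0 < eps -> exists k, forall m, (k <= m)%N -> m.+1%:R^-1 <= eps.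
  move=> e0; have [k] := ltr_add_invr e0; rewrite add0r => ke.
  exists k => m km; apply: le_trans (ltW ke).
  by rewrite lef_pV2 ?posrE// ler_nat.
have cz : cauchy (z_ @ \oo)%classic.
  apply: cauchy_exP => eps e0; have d0 : 0 < 2 * `|S| + 1 by rewrite ltr_wpDl// mulr_ge0.
  have [k kd] := small _ (divr_gt0 e0 d0).
  exists (z_ k); exists k => // m /= km; rewrite -ball_normE/=.
  apply: le_lt_trans (z_dist k m) _; have := kd k (leqnn k); have := kd m km.
  rewrite !ler_pdivlMr//; have := normr_ge0 S.
  have i0 j : 0 < j.+1%:R^-1 :> R by rewrite invr_gt0.
  have := i0 k; have := i0 m; set a := m.+1%:R^-1; set b := k.+1%:R^-1.
  by move: `|S| => T h1 h2 h3 h4 h5; nra.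
have zl : cvg (z_ @ \oo) %classic by exact: cauchy_cvg.
exists (lim (z_ @ \oo)%classic) => eps e0; have [k kd] := small _ e0.
have [k' _ k'd] := cvgr_dist_le _ _ zl _ e0.
exists (maxn k k'); first by apply: k'd => /=; exact: leq_maxr.
by apply: kd; exact: leq_maxl.
Qed.

(** [in_Cp] speaks only about least upper bounds that exist. Here one is obtained as the norm limit
    of the Cauchy sequence [z_]. *)
Lemma exists_pnorm_sum : exists z, is_pnorm_sum p x z.
Proof.
have [z zl] := z_lim; exists z; rewrite /is_pnorm_sum -qE; split.
  move=> _ [a [a1 ->]]; apply: ble_approx => eps e0.
  have d0 : 0 < 1 + `|S| by rewrite ltr_pwDl.
  have [m zm me] := zl _ (divr_gt0 e0 d0).
  exists ((z_ m - z) + m.+1%:R^-1 *: S).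
    apply: le_trans (ler_normD _ _) _; rewrite distrC normrZ ger0_norm ?invr_ge0//.
    apply: le_trans (lerD zm (ler_wpM2r (normr_ge0 S) me)) _.
    by rewrite -{1}[_ / _]mulr1 -mulrDr divfK ?gt_eqF.
  by rewrite addrA [z + _]addrC subrK; exact: grid_upper.
move=> w wub; apply: ble_approx => eps e0; have [m zm _] := zl _ e0.
exists (z - z_ m) => //; rewrite -{1}(subrK (z_ m) z) addrC; apply: ble_add.
by apply: z_le => a a1; apply: wub; exists a.
Qed.

End PConvex.

(** The exponent whose unit ball of coefficients keeps combinations below the majorant: the dual
    exponent for the [l_p] sum, [1] for the supremum. Through it the two classes share the arguments
    below. *)
Definition class_exp (R : realType) (c : lattice_class) (p : R) : R :=
  if c is ClassCp then p / (p - 1) else 1.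

Lemma class_majorant (R : realType) (p : R) (c : lattice_class) (X : BanachLattice R)
    (I : Type) (s : seq I) (x : I -> X) :
  1 < p -> in_class c p X -> (forall i, ble 0 (x i)) ->
  exists z : X, [/\ ble 0 z, `|z| <= (\sum_(i <- s) `|x i| `^ p) `^ p^-1 &
    forall a : I -> R, (forall i, 0 <= a i) ->
      \sum_(i <- s) a i `^ class_exp c p <= 1 ->
      ble (\sum_(i <- s) a i *: x i) z].
Proof.
rewrite /class_exp; case: c => p1 /= XC x0; last first.
  have [z [z0 nz za]] := upper_estimate_majorant p1 XC s x0.
  exists z; split=> // a a0 a1; apply: ble_trans (za a a0) _.
  rewrite -{2}(scale1r z); apply: ble_scalel => //.
  by apply: le_trans a1; apply: ler_sum => i _; rewrite powRr1.
pose y (k : 'I_(size s)) := x (tnth (in_tuple s) k).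
have [z zE] := exists_pnorm_sum p1 erefl (fun k => x0 (tnth (in_tuple s) k) : ble 0 (y k)).
have q0 : p / (p - 1) != 0 by have := conj_exp_gt1 p1 erefl => h; rewrite gt_eqF//; lra.
have z0 : ble 0 z.
  apply: zE.1; exists (fun=> 0); rewrite !big1// => i _; first by rewrite scale0r.
  by rewrite normr0 powR0.
exists z; split=> //; first by have := XC _ _ _ zE; rewrite (big_tnth _ _ s).
move=> a a0 a1; apply: zE.1; exists (fun k => a (tnth (in_tuple s) k)).
rewrite -(big_tnth _ _ s xpredT (fun i => a i *: x i)); split=> //.
move: a1; rewrite (big_tnth _ _ s); congr (_ <= _).
by apply: eq_bigr => k _; rewrite ger0_norm.
Qed.

(** * Optimal weights *)

(** The limit is the supremum of the levels [r] such that [r <= f] on a set of [G]. *)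
Lemma ultra_lim (R : realType) (T : Type) (G : set_system T) (f : T -> R) :
  UltraFilter G -> (forall m, 0 <= f m <= 1) ->
  exists l, forall eps, 0 < eps -> G [set m | `|f m - l| <= eps]%classic.
Proof.
move=> uG f01; pose E := [set r | G [set m | r <= f m]]%classic.
have E0 : E 0 by apply: filterS filterT => m _ /=; case/andP: (f01 m).
have E1 : ubound E 1.
  move=> r /filter_ex[m /= rm]; apply: le_trans rm _; by case/andP: (f01 m).
have hE : has_sup E by split; [exists 0|exists 1].
exists (sup E) => eps e0.
have [r Er rl] := sup_adherent e0 hE.
have [Gl|Gl] := in_ultra_setVsetC [set m | sup E + eps <= f m]%classic uG.
  have : sup E + eps <= sup E by apply: ub_le_sup => //; exists 1.
  lra.
apply: filterS (filterI Er Gl) => m /= [rm /negP]; rewrite -ltNge => fm.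
by rewrite ler_norml; apply/andP; split; lra.
Qed.

Section Weights.
Variables (R : realType) (p : R) (c : lattice_class) (X : BanachLattice R).
Variables (n : nat) (phi : 'I_n -> X -> R).
Hypotheses (p_gt1 : 1 < p) (XC : in_class c p X).
Hypothesis phi_pos : forall i, pos_form (phi i).
Hypothesis phi_norm : forall x, ble 0 x -> \sum_(i < n) phi i x <= `|x|.

Let s := class_exp c p.
Let p0 : 0 < p. Proof. by move: p_gt1; lra. Qed.
Let s_ge1 : 1 <= s.
Proof.
by rewrite /s /class_exp; case: (c) => //; have := conj_exp_gt1 p_gt1 erefl; lra.
Qed.
Let s0 : 0 < s. Proof. by have := s_ge1; lra. Qed.

Let family (L : nat) (x : nat -> X) (a : nat -> 'I_n -> R) :=
  [/\ forall l, ble 0 (x l), forall l i, 0 <= a l i,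
      forall i, \sum_(l < L) a l i `^ s <= 1 & \sum_(l < L) `|x l| `^ p <= 1].

Let profile (f : 'I_n -> R) := exists L x a, family L x a /\
  forall i, f i = \sum_(l < L) a l i * phi i (x l).

Let profile_ge0 f i : profile f -> 0 <= f i.
Proof.
move=> [L [x [a [[x0 a0 _ _] ->]]]]; apply: sumr_ge0 => l _.
by rewrite mulr_ge0//; exact: pos_form_ge0.
Qed.

(** The coefficients vary with [i], yet one majorant [z] of norm at most [1] gives [f i <= phi i z]
    for all [i] at once. *)
Let profile_le1 f : profile f -> \sum_(i < n) f i <= 1.
Proof.
move=> [L [x [a [[x0 a0 a1 x1] fE]]]].
have [z [z0 nz za]] := class_majorant (index_enum 'I_L) p_gt1 XC (fun l : 'I_L => x0 l).
apply: le_trans (le_trans (phi_norm z0) (le_trans nz _)).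
  apply: ler_sum => i _; rewrite fE.
  have := za (fun l => a l i) (fun l => a0 l i) (a1 i).
  move=> /(pos_form_le (phi_pos i)); rewrite (pos_form_sum (phi_pos i)).
  by under eq_bigr do rewrite (pos_formZ (phi_pos i)).
have -> : 1 = 1 `^ p^-1 :> R by rewrite powR1.
apply: powR_le => //; first by rewrite invr_ge0 ltW.
by apply: sumr_ge0 => l _; exact: powR_ge0.
Qed.

Let profile0 : profile (fun=> 0).
Proof.
exists 0%N, (fun=> 0), (fun _ _ => 0); split; last by move=> i; rewrite big_ord0.
by split=> *; rewrite ?big_ord0//; exact: ble_refl.
Qed.

Let cobound (b : R) : R := (1 - b `^ s) `^ s^-1.

(** The profile after [t *: x] joins the family with coefficients [b]: [cobound] shrinks the old
    coefficients to make room for [b], and the prefactor renormalises the [p]-th powers of the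
    norms. *)
Let extend (f b : 'I_n -> R) (x : X) (t : R) i :=
  (1 + t `^ p) `^ (- p^-1) * (t * b i * phi i x + cobound (b i) * f i).

Let profile_extend (f b : 'I_n -> R) (x : X) (t : R) : profile f ->
  (forall i, 0 <= b i <= 1) -> ble 0 x -> `|x| <= 1 -> 0 <= t -> profile (extend f b x t).
Proof.
move=> [L [y [a [[y0 a0 a1 y1] fE]]]] b01 x0 x1 t0.
pose k := (1 + t `^ p) `^ (- p^-1).
have tp0 : 0 <= t `^ p := powR_ge0 _ _.
have k0 : 0 <= k := powR_ge0 _ _.
have kp : k `^ p = (1 + t `^ p)^-1.
  by rewrite /k -powRrM mulNr mulVf ?gt_eqF// powR_inv1// addr_ge0.
exists L.+1, (fun l => if l is l'.+1 then k *: y l' else (k * t) *: x),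
  (fun l i => if l is l'.+1 then cobound (b i) * a l' i else b i).
have bs i : 0 <= 1 - b i `^ s.
  have /andP[b0 b1] := b01 i; rewrite subr_ge0.
  by have := @powR_le R (b i) 1 s (ltW s0) b0 b1; rewrite powR1.
split; last first.
  move=> i; rewrite big_ord_recl/= /extend -/k (pos_formZ (phi_pos i)) mulrDr; congr (_ + _).
    by ring.
  rewrite fE !mulr_sumr; apply: eq_bigr => l _; rewrite (pos_formZ (phi_pos i)); ring.
split.
- by case=> [|l]; apply: ble_scale0 => //; exact: mulr_ge0.
- by case=> [|l] i; [case/andP: (b01 i)|rewrite mulr_ge0// powR_ge0].
- move=> i; rewrite big_ord_recl/=.
  under eq_bigr do rewrite powRM ?powR_ge0//.
  rewrite -mulr_sumr /cobound powRK//.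
  have := ler_wpM2l (bs i) (a1 i); lra.
- rewrite big_ord_recl/=.
  under eq_bigr do rewrite normrZ ger0_norm// powRM//.
  rewrite -mulr_sumr kp normrZ ger0_norm ?mulr_ge0// powRM ?mulr_ge0//.
  rewrite powRM// kp -mulrA -mulrDr mulrC ler_pdivrMr ?ltr_wpDr// mul1r addrC.
  apply: lerD => //; rewrite -[leRHS]mulr1; apply: ler_wpM2l => //.
  by have := @powR_le R `|x| 1 p (ltW p0) (normr_ge0 _) x1; rewrite powR1.
Qed.

(* [w] is a limit of profiles whose total mass tends to the supremum; the inequality is the
   first-order optimality condition, tested against the perturbation [extend]. *)
Lemma exists_optimal_weights : exists w : 'I_n -> R,
  [/\ forall i, 0 <= w i, \sum_(i < n) w i <= 1 &
  forall (b : 'I_n -> R) (x : X) (t : R), (forall i, 0 <= b i <= 1) ->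
    ble 0 x -> `|x| <= 1 -> 0 <= t ->
    t * \sum_(i < n) b i * phi i x + \sum_(i < n) (1 - b i `^ s) `^ s^-1 * w i
    <= \sum_(i < n) w i + t `^ p / p].
Proof.
pose E := [set r | exists2 f, profile f & r = \sum_(i < n) f i]%classic.
have E1 : ubound E 1 by move=> _ [f pf ->]; exact: profile_le1.
have E0 : E 0 by exists (fun=> 0) => //; rewrite big1.
have hE : has_sup E by split; [exists 0|exists 1].
pose C := sup E.
have EC f : profile f -> \sum_(i < n) f i <= C.
  by move=> pf; apply: ub_le_sup; [exists 1|exists f].
have C1 : C <= 1 by apply: ge_sup; [exists 0|].
have C0 : 0 <= C by apply: ub_le_sup; first by exists 1.
have /choice[f_ fP] (m : nat) : exists f, profile f /\ C - m.+1%:R^-1 < \sum_(i < n) f i.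
  have m0 : 0 < m.+1%:R^-1 :> R by rewrite invr_gt0.
  by have [_ [f pf ->] h] := sup_adherent m0 hE; exists f.
have f01 i m : 0 <= f_ m i <= 1.
  have pf := (fP m).1; rewrite (profile_ge0 i pf)/=.
  apply: le_trans (profile_le1 pf); rewrite (bigD1 i)//= lerDl.
  by apply: sumr_ge0 => j _; exact: profile_ge0.
have [G [uG Goo]] := ultraFilterLemma (eventually_filter).
have /choice[w wl] i := ultra_lim uG (f01 i).
have near_ex (eps : R) : 0 < eps -> exists m,
    (forall i, `|f_ m i - w i| <= eps) /\ m.+1%:R^-1 <= eps.
  move=> e0; have [k] := ltr_add_invr e0; rewrite add0r => ke.
  have G1 : G [set m | (k <= m)%N]%classic by apply: Goo; exists k.
  have G2 : G [set m | forall i, `|f_ m i - w i| <= eps]%classic.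
    by apply: filter_forall => i; exact: wl.
  have [m [/= km h]] := filter_ex (filterI G1 G2); exists m; split=> //.
  by apply: le_trans (ltW ke); rewrite lef_pV2 ?posrE// ler_nat.
(* Linear inequalities with coefficients in [[-1, 1]] pass from [f_ m] to the limit [w]. The
   tolerance is cut into [n + 1] shares: one per coordinate, one for [1 / (m + 1)]. *)
have approx (u : 'I_n -> R) (D : R) : (forall i, `|u i| <= 1) ->
    (forall m, \sum_(i < n) u i * f_ m i <= D + m.+1%:R^-1) ->
    \sum_(i < n) u i * w i <= D.
  move=> u1 h; apply/ler_addgt0Pl => eps e0.
  have n0 : 0 < n.+1%:R :> R by rewrite ltr0n.
  have [m [fw me]] := near_ex _ (divr_gt0 e0 n0).
  have : \sum_(i < n) (u i * w i - u i * f_ m i) <= \sum_(i < n) (eps / n.+1%:R).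
    apply: ler_sum => i _; rewrite -mulrBr; apply: le_trans (ler_norm _) _.
    rewrite normrM distrC -[leRHS]mul1r; apply: ler_pM => //.
  rewrite sumrB sumr_const card_ord -[X in _ <= X -> _]mulr_natl; have := h m.
  have : n%:R * (eps / n.+1%:R) + eps / n.+1%:R = eps.
    by rewrite -{2}[eps / _]mul1r -mulrDl natr1 mulrC divfK ?gt_eqF.
  move=> e1 e2; rewrite lerBlDr => /le_trans; apply.
  have -> : eps + D = n%:R * (eps / n.+1%:R) + (D + eps / n.+1%:R).
    by rewrite [D + _]addrC addrA e1.
  by apply: lerD (lexx _) (le_trans e2 _); exact: lerD (lexx _) me.
exists w; split.
- move=> i; apply/ler_addgt0Pl => eps e0; have [m [/(_ i) h _]] := near_ex _ e0.
  by have /andP[] := f01 i m; move: h; rewrite ler_norml => /andP[]; lra.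
- have := approx (fun=> 1) 1; under eq_bigr do rewrite mul1r; apply; first by rewrite normr1.
  move=> m; under eq_bigr do rewrite mul1r.
  by apply: le_trans (profile_le1 (fP m).1) _; rewrite lerDl invr_ge0.
move=> b x t b01 x0 x1 t0.
have tp0 : 0 <= t `^ p := powR_ge0 _ _.
have cb i : 0 <= cobound (b i) <= 1.
  rewrite powR_ge0/=; have /andP[b0 b1] := b01 i.
  have bs := @powR_le R (b i) 1 s (ltW s0) b0 b1; rewrite powR1 in bs.
  have := @powR_le R (1 - b i `^ s) 1 s^-1; rewrite powR1; apply.
  + by rewrite invr_ge0 ltW.
  + by rewrite subr_ge0.
  + by have := powR_ge0 (b i) s; lra.
set A : R := \sum_(i < n) b i * phi i x.
have := approx (fun i => cobound (b i) - 1) (t `^ p / p - t * A).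
under eq_bigr do rewrite mulrBl mul1r.
rewrite sumrB => h; suff : \sum_(i < n) cobound (b i) * w i - \sum_(i < n) w i <=
    t `^ p / p - t * A by rewrite /cobound; lra.
apply: h => [i|m]; first by have /andP[] := cb i; rewrite ler_norml => ? ?; apply/andP; split; lra.
under eq_bigr do rewrite mulrBl mul1r.
rewrite sumrB.
have := EC _ (profile_extend (fP m).1 b01 x0 x1 t0).
rewrite /extend -mulr_sumr powRN mulrC ler_pdivrMr ?powR_gt0 ?ltr_wpDr//.
rewrite big_split/=; under eq_bigr do rewrite -mulrA.
rewrite -mulr_sumr -/A.
(* With [C <= 1], Bernoulli turns the renormalising factor into the additive error [t^p / p]. *)
have e1 : (1 + t `^ p) `^ p^-1 <= 1 + t `^ p / p := powR_add1_le p_gt1 erefl tp0.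
have e2 : C * (1 + t `^ p) `^ p^-1 <= C * (1 + t `^ p / p) by apply: ler_wpM2l.
have e3 : C * (t `^ p / p) <= t `^ p / p.
  by rewrite -[leRHS]mul1r; apply: ler_wpM2r => //; rewrite divr_ge0// ltW.
have := (fP m).2; move: e1 e2 e3; move: (t `^ p / p) ((1 + t `^ p) `^ p^-1) (m.+1%:R^-1) => u v r.
move: (\sum_(i < n) f_ m i) (\sum_(i < n) cobound (b i) * f_ m i) (t * A) => S1 S2 TA.
lra.
Qed.

Let q := p / (p - 1).

Lemma gamma_pE : gamma_p p = q `^ q^-1.
Proof.
have e := conj_expV p_gt1 erefl; rewrite -/q in e.
have q0 : 0 < q by have := conj_exp_gt1 p_gt1 erefl; rewrite -/q; lra.
rewrite /gamma_p (_ : 1 - p^-1 = q^-1); last by lra.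
rewrite (_ : p^-1 - 1 = - q^-1); last by lra.
by rewrite -{1}powR_inv1 ?(ltW q0)// -powRrM mulN1r opprK.
Qed.

(** For [s = 1] the optimality condition is already Young's inequality for [q * B], whence
    [gamma_p]. For [s = q] it is applied infinitesimally, to small multiples of [b], where
    [1 - (1 - u)^(1/q)] behaves like [u / q]; this gains the factor [1 / q] and leaves the constant
    [1]. *)
Lemma exists_weights : exists w : 'I_n -> R,
  [/\ forall i, 0 <= w i, \sum_(i < n) w i <= 1 &
  forall (b : 'I_n -> R) (x : X), (forall i, 0 <= b i <= 1) -> ble 0 x ->
    \sum_(i < n) b i * phi i x <=
    (if c is ClassCp then 1 else gamma_p p) * `|x| * (\sum_(i < n) b i `^ s * w i) `^ q^-1].
Proof.
have [w [w0 w1 wP]] := exists_optimal_weights; exists w; split=> //.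
suff norm1 (b : 'I_n -> R) (x : X) : (forall i, 0 <= b i <= 1) -> ble 0 x -> `|x| <= 1 ->
    \sum_(i < n) b i * phi i x <=
    (if c is ClassCp then 1 else gamma_p p) * (\sum_(i < n) b i `^ s * w i) `^ q^-1.
  move=> b x b01 x0; have [x00|xn0] := eqVneq `|x| 0.
    rewrite x00 mulr0 mul0r; apply: sumr_le0 => i _.
    have -> : x = 0 by apply/eqP; rewrite -normr_eq0 x00.
    by rewrite (pos_form0 (phi_pos i)) mulr0.
  have xp : 0 < `|x| by rewrite lt0r xn0 normr_ge0.
  have := norm1 b (`|x|^-1 *: x) b01; rewrite normrZ ger0_norm ?invr_ge0// mulVf//.
  move=> /(_ (ble_scale0 _ x0) (lexx _)); rewrite invr_ge0 normr_ge0 => /(_ erefl).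
  under eq_bigr do rewrite (pos_formZ (phi_pos _)) mulrCA.
  by rewrite -mulr_sumr -ler_pdivlMl ?invr_gt0// invrK mulrA [`|x| * _]mulrC.
move=> b01 x0 x1; set A := \sum_(i < n) b i * phi i x.
set B := \sum_(i < n) b i `^ s * w i.
have B0 : 0 <= B by apply: sumr_ge0 => i _; rewrite mulr_ge0// powR_ge0.
have q1 : 1 < q := conj_exp_gt1 p_gt1 erefl.
have q0 : 0 < q by lra.
move: B0 wP; rewrite /B /s /class_exp; case: (c) => B0 wP.
- rewrite mul1r -/q; apply: (le_of_young p_gt1 erefl); first exact: B0.
  rewrite -/q in wP B0 *; rewrite -/q; set B' := \sum_(i < n) _.
  move=> t t0.
  (* With [v = tau^q], replace [b] by [tau * b] and [t] by [t * tau^(q-1)]. Since [(q - 1) * p = q],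
     both [t * A] and [t^p] are multiplied by [v], which then cancels. *)
  have key (v : R) : 0 < v -> v < 1 -> (t * A - t `^ p / p) * (1 - v) <= B' / q.
    move=> v0 v1; have [tau [tau0 tau1 tauq]] : exists tau, [/\ 0 < tau, tau <= 1 & tau `^ q = v].
      exists (v `^ q^-1); split; [by rewrite powR_gt0| |by rewrite powRK// ltW].
      by have := @powR_le R v 1 q^-1; rewrite powR1; apply; rewrite ?invr_ge0; lra.
    have tau01 i : 0 <= tau * b i <= 1.
      have /andP[b0 b1] := b01 i; rewrite mulr_ge0 ?(ltW tau0)//=.
      by rewrite -[1]mulr1; apply: ler_pM => //; exact: ltW.
    have := wP _ x (t * tau `^ (q - 1)) tau01 x0 x1 (mulr_ge0 (ltW t0) (powR_ge0 _ _)).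
    have -> : \sum_(i < n) tau * b i * phi i x = tau * A.
      by rewrite mulr_sumr; apply: eq_bigr => i _; rewrite mulrA.
    have -> : t * tau `^ (q - 1) * (tau * A) = v * (t * A).
      have -> : v = tau * tau `^ (q - 1) by rewrite mulr_powRB1 ?(ltW tau0).
      by move: (tau `^ (q - 1)) => *; ring.
    rewrite powRM ?(ltW t0) ?powR_ge0// -powRrM.
    have -> : (q - 1) * p = q by rewrite /q; field; apply/eqP; move: p_gt1; lra.
    rewrite tauq.
    have : \sum_(i < n) (w i - (1 - (tau * b i) `^ q) `^ q^-1 * w i) <=
           \sum_(i < n) v / q / (1 - v) * (b i `^ q * w i).
      apply: ler_sum => i _; have /andP[b0 b1] := b01 i.
      rewrite powRM ?(ltW tau0)// tauq; set u := v * b i `^ q.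
      have bq1 : b i `^ q <= 1.
        by have := @powR_le R (b i) 1 q (ltW q0) b0 b1; rewrite powR1.
      have u0 : 0 <= u by rewrite mulr_ge0 ?powR_ge0// ltW.
      have uv : u <= v by rewrite -[leRHS]mulr1; apply: ler_wpM2l => //; exact: ltW.
      rewrite -{1}[w i]mul1r -mulrBl [leRHS]mulrA; apply: ler_wpM2r => //.
      apply: le_trans (powR_sub1_ge p_gt1 erefl u0 (le_lt_trans uv v1)) _; rewrite -/q.
      have -> : v / q / (1 - v) * b i `^ q = u / q / (1 - v).
        by rewrite /u; move: q^-1 (1 - v)^-1 (b i `^ q) => *; ring.
      apply: ler_wpM2l; first by rewrite divr_ge0// ltW.
      by rewrite lef_pV2 ?posrE; lra.
    rewrite sumrB -mulr_sumr -/B'.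
    move: (\sum_(i < n) w i) (\sum_(i < n) (1 - _) `^ _ * w i) => S1 S2 h1 h2.
    have h3 : v * (t * A) <= v / q / (1 - v) * B' + t `^ p * v / p.
      by move: (v / q / _ * _) (v * (t * A)) (_ * v / p) h1 h2 => *; lra.
    have v1' : 0 < 1 - v by lra.
    have h4 : v * (t * A - t `^ p / p) <= v * (B' / q / (1 - v)).
      have -> : v * (t * A - t `^ p / p) = v * (t * A) - t `^ p * v / p.
        by move: p^-1 (t `^ p) => *; ring.
      have -> : v * (B' / q / (1 - v)) = v / q / (1 - v) * B'.
        by move: q^-1 (1 - v)^-1 => *; ring.
      by rewrite lerBlDr.
    by rewrite ler_pM2l// ler_pdivlMr in h4.
  rewrite -lerBlDr leNgt; apply/negP; set D := t * A - _; set G := B' / q => GD.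
  have G0 : 0 <= G by rewrite divr_ge0// ltW.
  have D0 : 0 < D by exact: le_lt_trans G0 GD.
  (* In place of a limit [v -> 0]: this [v] makes [D * (1 - v)] the midpoint of [D] and [G]. *)
  have := key ((D - G) / (2 * D)); rewrite -/D -/G.
  have -> : D * (1 - (D - G) / (2 * D)) = (D + G) / 2 by field; rewrite gt_eqF.
  have : 0 < (D - G) / (2 * D) by rewrite divr_gt0 ?mulr_gt0// subr_gt0.
  have : (D - G) / (2 * D) < 1 by rewrite ltr_pdivrMr ?mulr_gt0//; lra.
  by move=> h1 h2 /(_ h2 h1); lra.
- rewrite gamma_pE -powRM ?(ltW q0)//; set B' := \sum_(i < n) _ in B0 *.
  apply: (le_of_young p_gt1 erefl); first by rewrite mulr_ge0// ltW.
  move=> t t0; rewrite -/q mulrAC mulfV ?gt_eqF// mul1r.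
  have := wP b x t b01 x0 x1 (ltW t0); rewrite -/A.
  have -> : \sum_(i < n) (1 - b i `^ 1) `^ 1^-1 * w i = \sum_(i < n) w i - B'.
    rewrite /B' -sumrB; apply: eq_bigr => i _; have /andP[b0 b1] := b01 i.
    by rewrite invr1 !powRr1 ?subr_ge0 ?powRr1// mulrBl mul1r.
  by move: (\sum_(i < n) w i) (t `^ p / p) (t * A) => *; lra.
Qed.

End Weights.

(** * Reduced products *)

(* Indices [d] carry a finite weighted cell space; [pd_rank] tends to infinity along the
   filter, which makes the reduced product below complete. *)
Record prod_data (R : realType) := ProdData {
  pd_index : Type;
  pd_filter : set_system pd_index;
  pd_proper : ProperFilter pd_filter;
  pd_size : pd_index -> nat;
  pd_weight : pd_index -> nat -> R;
  pd_rank : pd_index -> nat;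
  pd_exp : R;
  pd_root : R;
  pd_rank_cvg : forall k, pd_filter [set d | (k <= pd_rank d)%N]%classic
}.

#[local] Existing Instance pd_proper.

Section ReducedProduct.
Variables (R : realType) (P : prod_data R).
Notation D := (pd_index P).
Notation U := (@pd_filter R P).
Notation n := (@pd_size R P).

(** Entries are indexed by all of [nat] to avoid a type depending on [d]; bounds see only those
    below the size of [d], so the quotient forgets the others. *)
Definition pvec := D -> nat -> R.
Implicit Types u v w : pvec.

Definition gauge (d : D) (b : nat -> R) : R :=
  (\sum_(i < n d) b i `^ pd_exp P * pd_weight d i) `^ pd_root P.

(** Norm at most [r], expressed by duality. For positive weights, exponent [q] and root [1/q], it is
    the norm of [v / weight] in [L_p] of the weights; for exponent [1] it is a dual form of the weak
    [L_p] norm. *)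
Definition bound_at (d : D) (v : nat -> R) (r : R) := forall b : nat -> R,
  (forall i, 0 <= b i <= 1) -> \sum_(i < n d) b i * `|v i| <= r * gauge d b.

Definition ebound v (r : R) := U [set d | bound_at d (v d) r]%classic.

Definition bounded_vec v := exists2 r, 0 <= r & ebound v r.

Definition null_vec v := forall r, 0 < r -> ebound v r.

Lemma gauge_ge0 d b : 0 <= gauge d b. Proof. exact: powR_ge0. Qed.

Lemma bound_at_le d (u v : nat -> R) (r : R) : (forall i, (i < n d)%N -> `|u i| <= `|v i|) ->
  bound_at d v r -> bound_at d u r.
Proof.
move=> uv vr b b01; apply: le_trans (vr b b01); apply: ler_sum => i _.
by apply: ler_wpM2l; [case/andP: (b01 i)|exact: uv].
Qed.

Lemma bound_atW d (v : nat -> R) (r r' : R) : r <= r' -> bound_at d v r -> bound_at d v r'.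
Proof.
by move=> rr vr b b01; apply: le_trans (vr b b01) _; apply: ler_wpM2r; rewrite ?gauge_ge0.
Qed.

Lemma bound_atD d (u v w : nat -> R) (r r' : R) :
  (forall i, (i < n d)%N -> `|w i| <= `|u i| + `|v i|) ->
  bound_at d u r -> bound_at d v r' -> bound_at d w (r + r').
Proof.
move=> wuv ur vr b b01; rewrite mulrDl; apply: le_trans (lerD (ur b b01) (vr b b01)).
rewrite -big_split/=; apply: ler_sum => i _; rewrite -mulrDr.
by apply: ler_wpM2l; [case/andP: (b01 i)|exact: wuv].
Qed.

Lemma ebound_le u v (r : R) : (forall d i, `|u d i| <= `|v d i|) -> ebound v r -> ebound u r.
Proof. by move=> uv; apply: filterS => d /=; apply: bound_at_le => i _; exact: uv. Qed.

Lemma eboundW v (r r' : R) : r <= r' -> ebound v r -> ebound v r'.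
Proof. by move=> rr; apply: filterS => d /=; exact: bound_atW. Qed.

Lemma eboundD u v w (r r' : R) : (forall d i, `|w d i| <= `|u d i| + `|v d i|) ->
  ebound u r -> ebound v r' -> ebound w (r + r').
Proof.
move=> wuv ur vr; apply: filterS (filterI ur vr) => d /= [].
by apply: bound_atD => i _; exact: wuv.
Qed.

Definition vadd u v : pvec := fun d i => u d i + v d i.
Definition vscale (a : R) u : pvec := fun d i => a * u d i.
Definition vmax u v : pvec := fun d i => Num.max (u d i) (v d i).
Definition vsub u v : pvec := fun d i => u d i - v d i.

Lemma eboundZ (a : R) v (r : R) : ebound v r -> ebound (vscale a v) (`|a| * r).
Proof.
apply: filterS => d /= vr b b01; rewrite -mulrA.
apply: le_trans (ler_wpM2l (normr_ge0 a) (vr b b01)); rewrite mulr_sumr.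
by apply: ler_sum => i _; rewrite normrM mulrCA.
Qed.

Lemma ebound0 (r : R) : 0 <= r -> ebound (fun _ _ => 0) r.
Proof.
move=> r0; apply: filterS filterT => d _ b b01; rewrite big1; first by rewrite mulr_ge0// gauge_ge0.
by move=> i _; rewrite normr0 mulr0.
Qed.

Lemma bounded0 : bounded_vec (fun _ _ => 0).
Proof. by exists 0 => //; exact: ebound0. Qed.

Lemma boundedD u v w : (forall d i, `|w d i| <= `|u d i| + `|v d i|) ->
  bounded_vec u -> bounded_vec v -> bounded_vec w.
Proof.
move=> h [r r0 ur] [r' r'0 vr]; exists (r + r'); first exact: addr_ge0.
exact: eboundD h ur vr.
Qed.

Lemma boundedZ (a : R) v : bounded_vec v -> bounded_vec (vscale a v).
Proof.
by move=> [r r0 vr]; exists (`|a| * r); [rewrite mulr_ge0|exact: eboundZ].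
Qed.

Lemma bounded_vadd u v : bounded_vec u -> bounded_vec v -> bounded_vec (vadd u v).
Proof. by apply: boundedD => d i; exact: ler_normD. Qed.

Lemma bounded_vsub u v : bounded_vec u -> bounded_vec v -> bounded_vec (vsub u v).
Proof. by apply: boundedD => d i; exact: ler_normB. Qed.

Lemma norm_max_le (a b : R) : `|Num.max a b| <= `|a| + `|b|.
Proof. by rewrite /Num.max; case: ifP => _; rewrite ?lerDl ?lerDr. Qed.

Lemma bounded_vmax u v : bounded_vec u -> bounded_vec v -> bounded_vec (vmax u v).
Proof. by apply: boundedD => d i; exact: norm_max_le. Qed.

Lemma null_le u v w : (forall d i, `|w d i| <= `|u d i| + `|v d i|) ->
  null_vec u -> null_vec v -> null_vec w.
Proof.
move=> h un vn r r0; have r2 : 0 < r / 2 by rewrite divr_gt0.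
rewrite (splitr r); exact: eboundD h (un _ r2) (vn _ r2).
Qed.

Lemma null0 : null_vec (fun _ _ => 0).
Proof. by move=> r r0; apply: ebound0; exact: ltW. Qed.

Lemma null_le1 u w : (forall d i, `|w d i| <= `|u d i|) -> null_vec u -> null_vec w.
Proof. by move=> h un r r0; exact: ebound_le h (un _ r0). Qed.

Lemma null_vsub_refl v : null_vec (vsub v v).
Proof. by apply: null_le1 null0 => d i; rewrite /vsub subrr. Qed.

Lemma nullZ (a : R) v : null_vec v -> null_vec (vscale a v).
Proof.
move=> vn r r0; have a0 : 0 < `|a| + 1 by rewrite ltr_wpDl.
have := eboundZ a (vn _ (divr_gt0 r0 a0)); apply: eboundW.
by rewrite mulrCA -[leRHS]mulr1 ler_pM2l// ler_pdivrMr// mul1r lerDl.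
Qed.

Definition pseudo_norm v : R := inf [set r | 0 <= r /\ ebound v r]%classic.

Lemma pseudo_norm_ge0 v : 0 <= pseudo_norm v.
Proof.
have [[r [r0 vr]]|n0] := pselect (exists r, 0 <= r /\ ebound v r).
  by apply: lb_le_inf; [exists r|move=> x []].
(* An unbounded vector gets the infimum of the empty set, which is [0]. *)
rewrite /pseudo_norm (_ : mkset _ = set0)%classic ?inf0//.
by apply/seteqP; split=> // x /= h; apply: n0; exists x.
Qed.

Lemma pseudo_norm_le v (r : R) : 0 <= r -> ebound v r -> pseudo_norm v <= r.
Proof. by move=> r0 vr; apply: ge_inf => //; exists 0 => x []. Qed.

Lemma pseudo_norm_lt v (r : R) : bounded_vec v -> pseudo_norm v < r -> ebound v r.
Proof.
move=> [r0 r00 vr0] nr; have e0 : 0 < r - pseudo_norm v by rewrite subr_gt0.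
have [|x [x0 vx]] := @inf_adherent R [set r | 0 <= r /\ ebound v r]%classic _ e0.
  by split; [exists r0|exists 0 => x []].
rewrite -/(pseudo_norm v) addrC subrK => xr.
exact: eboundW (ltW xr) vx.
Qed.

Lemma pseudo_normD u v w : (forall d i, `|w d i| <= `|u d i| + `|v d i|) ->
  bounded_vec u -> bounded_vec v -> pseudo_norm w <= pseudo_norm u + pseudo_norm v.
Proof.
move=> h bu bv; apply/ler_addgt0Pl => eps e0.
have e2 : 0 < eps / 2 by rewrite divr_gt0.
rewrite (splitr eps) addrACA; apply: pseudo_norm_le.
  by rewrite !addr_ge0 ?pseudo_norm_ge0// ltW.
by apply: eboundD h _ _; apply: pseudo_norm_lt; rewrite // ltrDr.
Qed.

Lemma pseudo_normZ_le (a : R) v : bounded_vec v ->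
  pseudo_norm (vscale a v) <= `|a| * pseudo_norm v.
Proof.
move=> bv; have [->|a0] := eqVneq a 0.
  rewrite normr0 mul0r; apply: pseudo_norm_le => //.
  by apply: ebound_le (ebound0 (lexx _)) => d i; rewrite /vscale mul0r.
have a0' : 0 < `|a| by rewrite normr_gt0.
rewrite -ler_pdivrMl//; apply/ler_addgt0Pl => eps e0.
rewrite ler_pdivrMl//; apply: pseudo_norm_le.
  by rewrite mulr_ge0// addr_ge0 ?pseudo_norm_ge0// ltW.
by apply: eboundZ; apply: pseudo_norm_lt; rewrite // ltrDr.
Qed.

Lemma pseudo_norm_le_abs u v : (forall d i, `|u d i| <= `|v d i|) ->
  bounded_vec v -> pseudo_norm u <= pseudo_norm v.
Proof.
move=> h bv; have := pseudo_normD (v := fun _ _ => 0) _ bv bounded0 => /(_ u).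
have -> : pseudo_norm (fun _ _ => 0) = 0.
  by apply/eqP; rewrite eq_le pseudo_norm_ge0 andbT; apply: pseudo_norm_le => //; exact: ebound0.
by rewrite addr0; apply => d i; rewrite normr0 addr0.
Qed.

Lemma pseudo_normZ (a : R) v : bounded_vec v ->
  pseudo_norm (vscale a v) = `|a| * pseudo_norm v.
Proof.
move=> bv; apply/eqP; rewrite eq_le pseudo_normZ_le//=.
have [->|a0] := eqVneq a 0; first by rewrite normr0 mul0r pseudo_norm_ge0.
have := pseudo_normZ_le a^-1 (boundedZ a bv).
rewrite normfV ler_pdivlMl ?normr_gt0// => h; apply: le_trans h.
apply: ler_wpM2l => //; apply: pseudo_norm_le_abs; last by do 2 apply: boundedZ.
by move=> d i; rewrite /vscale mulrA mulVf// mul1r.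
Qed.

Lemma pseudo_norm_null v : bounded_vec v -> pseudo_norm v = 0 -> null_vec v.
Proof. by move=> bv v0 r r0; apply: pseudo_norm_lt => //; rewrite v0. Qed.

Lemma null_pseudo_norm v : null_vec v -> pseudo_norm v = 0.
Proof.
move=> vn; apply/eqP; rewrite eq_le pseudo_norm_ge0 andbT.
by apply/ler_addgt0Pl => eps e0; rewrite addr0; apply: pseudo_norm_le; [exact: ltW|exact: vn].
Qed.

(** * The quotient by null vectors *)

Definition vclass v : set pvec := [set w | null_vec (vsub w v)]%classic.

(** Cosets are kept as sets, so that equality in the quotient is plain equality. *)
Definition rp_type := {A : set pvec | exists2 v, bounded_vec v & A = vclass v}.

Lemma vclass_eq u v : null_vec (vsub u v) -> vclass u = vclass v.
Proof.
move=> uv; apply/seteqP; split=> w /= wu.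
  by apply: null_le wu uv => d i; rewrite /vsub -(subrKA (u d i)) ler_normD.
apply: null_le wu uv => d i; rewrite /vsub -[X in _ <= _ + X]normrN opprB.
by rewrite -(subrKA (v d i)) ler_normD.
Qed.

Lemma vclass_eq_null u v : vclass u = vclass v -> null_vec (vsub u v).
Proof. by move=> e; have : vclass v u by rewrite -e; exact: null_vsub_refl. Qed.

(** Made total by sending unbounded vectors to the class of [0]. *)
Definition vproj v : rp_type :=
  match pselect (bounded_vec v) with
  | left bv => exist _ (vclass v) (ex_intro2 _ _ v bv erefl)
  | right _ => exist _ (vclass (fun _ _ => 0)) (ex_intro2 _ _ _ bounded0 erefl)
  end.

Lemma vprojE v : bounded_vec v -> sval (vproj v) = vclass v.
Proof. by rewrite /vproj; case: pselect. Qed.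

Lemma rp_type_inj (y z : rp_type) : sval y = sval z -> y = z.
Proof. by case: y z => [A ?] [B ?] /= AB; exact: eq_exist. Qed.

Lemma vproj_eq u v : bounded_vec u -> bounded_vec v -> null_vec (vsub u v) ->
  vproj u = vproj v.
Proof. by move=> bu bv uv; apply: rp_type_inj; rewrite !vprojE//; exact: vclass_eq. Qed.

Lemma vproj_null u v : bounded_vec u -> bounded_vec v -> vproj u = vproj v ->
  null_vec (vsub u v).
Proof. by move=> bu bv /(congr1 sval); rewrite !vprojE// => /vclass_eq_null. Qed.

Definition vrepr (z : rp_type) : pvec := sval (cid2 (svalP z)).

Lemma vrepr_bounded z : bounded_vec (vrepr z).
Proof. by rewrite /vrepr; case: cid2. Qed.

Lemma vreprK z : vproj (vrepr z) = z.
Proof.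
apply: rp_type_inj; rewrite vprojE; last exact: vrepr_bounded.
by rewrite /vrepr; case: cid2.
Qed.

Lemma vprojK v : bounded_vec v -> null_vec (vsub (vrepr (vproj v)) v).
Proof. by move=> bv; apply: vproj_null => //; [exact: vrepr_bounded|exact: vreprK]. Qed.

Definition rp_add (y z : rp_type) := vproj (vadd (vrepr y) (vrepr z)).
Definition rp_scale (a : R) (z : rp_type) := vproj (vscale a (vrepr z)).
Definition rp_sup (y z : rp_type) := vproj (vmax (vrepr y) (vrepr z)).
Definition rp_norm (z : rp_type) := pseudo_norm (vrepr z).

Lemma rp_addE u v : bounded_vec u -> bounded_vec v ->
  rp_add (vproj u) (vproj v) = vproj (vadd u v).
Proof.
move=> bu bv; apply: vproj_eq.
- by apply: bounded_vadd; exact: vrepr_bounded.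
- exact: bounded_vadd.
- apply: null_le (vprojK bu) (vprojK bv) => d i.
  by rewrite /vsub /vadd opprD addrACA ler_normD.
Qed.

Lemma rp_scaleE (a : R) v : bounded_vec v -> rp_scale a (vproj v) = vproj (vscale a v).
Proof.
move=> bv; apply: vproj_eq; [apply: boundedZ; exact: vrepr_bounded|exact: boundedZ|].
by apply: null_le1 (nullZ a (vprojK bv)) => d i; rewrite /vsub /vscale mulrBr.
Qed.

Lemma dist_max_le (a b a' b' : R) :
  `|Num.max a b - Num.max a' b'| <= `|a - a'| + `|b - b'|.
Proof.
have h1 := ler_norm (a - a'); have h2 := ler_norm (b - b').
have h4 := normr_ge0 (a - a'); have h5 := normr_ge0 (b - b').
have h6 : - (a - a') <= `|a - a'| by rewrite -normrN ler_norm.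
have h7 : - (b - b') <= `|b - b'| by rewrite -normrN ler_norm.
move: (`|a - a'|) (`|b - b'|) h1 h2 h4 h5 h6 h7 => x y *.
by rewrite ler_norml; apply/andP; split;
  have [?|?] := leP a b; have [?|?] := leP a' b'; lra.
Qed.

Lemma rp_supE u v : bounded_vec u -> bounded_vec v ->
  rp_sup (vproj u) (vproj v) = vproj (vmax u v).
Proof.
move=> bu bv; apply: vproj_eq.
- by apply: bounded_vmax; exact: vrepr_bounded.
- exact: bounded_vmax.
- by apply: null_le (vprojK bu) (vprojK bv) => d i; exact: dist_max_le.
Qed.

Lemma rp_normE v : bounded_vec v -> rp_norm (vproj v) = pseudo_norm v.
Proof.
move=> bv; have bw := vrepr_bounded (vproj v); have h := vprojK bv.
have b' := bounded_vsub bw bv.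
apply/eqP; rewrite eq_le; apply/andP; split.
  rewrite -[leRHS]add0r -(null_pseudo_norm h); apply: pseudo_normD => // d i.
  by rewrite -{1}(subrK (v d i) (vrepr (vproj v) d i)) ler_normD.
rewrite -[leRHS]add0r -(null_pseudo_norm h); apply: pseudo_normD => // d i.
rewrite -[X in _ <= X + _]normrN opprB.
by rewrite -{1}(subrK (vrepr (vproj v) d i) (v d i)) ler_normD.
Qed.

Lemma rp_ind (Q : rp_type -> Prop) : (forall v, bounded_vec v -> Q (vproj v)) ->
  forall z, Q z.
Proof. by move=> h z; rewrite -(vreprK z); apply: h; exact: vrepr_bounded. Qed.

End ReducedProduct.

(** * Linear structure, norm and completeness of the quotient *)

Section ReducedProductStructure.
Variables (R : realType) (P : prod_data R).
Notation Z := (rp_type P).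
Implicit Types (y z : Z).

Let rp0 : Z := vproj (fun _ _ => 0).
Let rp_opp z : Z := rp_scale (-1) z.

Lemma rp_addA : associative (@rp_add R P).
Proof.
elim/rp_ind => u bu; elim/rp_ind => v bv; elim/rp_ind => w bw.
rewrite !rp_addE//; try exact: bounded_vadd.
by congr vproj; apply/funext => d; apply/funext => i; exact: addrA.
Qed.

Lemma rp_addC : commutative (@rp_add R P).
Proof.
elim/rp_ind => u bu; elim/rp_ind => v bv; rewrite !rp_addE//.
by congr vproj; apply/funext => d; apply/funext => i; exact: addrC.
Qed.

Lemma rp_add0 : left_id rp0 (@rp_add R P).
Proof.
elim/rp_ind => u bu; rewrite rp_addE//; last exact: bounded0.
by congr vproj; apply/funext => d; apply/funext => i; exact: add0r.
Qed.

Lemma rp_addN : left_inverse rp0 rp_opp (@rp_add R P).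
Proof.
elim/rp_ind => u bu; rewrite /rp_opp rp_scaleE// rp_addE//; last exact: boundedZ.
by congr vproj; apply/funext => d; apply/funext => i; rewrite /vadd /vscale mulN1r addNr.
Qed.

HB.instance Definition _ := gen_eqMixin Z.
HB.instance Definition _ := gen_choiceMixin Z.
HB.instance Definition _ := GRing.isZmodule.Build Z rp_addA rp_addC rp_add0 rp_addN.

Lemma rp_scaleA (a b : R) z : rp_scale a (rp_scale b z) = rp_scale (a * b) z.
Proof.
elim/rp_ind: z => u bu; rewrite !rp_scaleE//; last exact: boundedZ.
by congr vproj; apply/funext => d; apply/funext => i; exact: mulrA.
Qed.

Lemma rp_scale1 : left_id 1 (@rp_scale R P).
Proof.
elim/rp_ind => u bu; rewrite rp_scaleE//.
by congr vproj; apply/funext => d; apply/funext => i; exact: mul1r.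
Qed.

Lemma rp_scaleDr : right_distributive (@rp_scale R P) +%R.
Proof.
move=> a; elim/rp_ind => u bu; elim/rp_ind => v bv; rewrite /GRing.add/=.
have bau := boundedZ a bu; have bav := boundedZ a bv; have buv := bounded_vadd bu bv.
rewrite rp_addE// !rp_scaleE// rp_addE//.
by congr vproj; apply/funext => d; apply/funext => i; exact: mulrDr.
Qed.

Lemma rp_scaleDl z : {morph (@rp_scale R P)^~ z : a b / a + b}.
Proof.
move=> a b; elim/rp_ind: z => u bu; rewrite /GRing.add/= -/(a + b).
have bau := boundedZ a bu; have bbu := boundedZ b bu.
rewrite !rp_scaleE// rp_addE//.
by congr vproj; apply/funext => d; apply/funext => i; exact: mulrDl.
Qed.

HB.instance Definition _ := GRing.Zmodule_isLmodule.Build R Z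
  rp_scaleA rp_scale1 rp_scaleDr rp_scaleDl.

Lemma vprojD u v : bounded_vec u -> bounded_vec v ->
  vproj (vadd u v) = vproj u + vproj v :> Z.
Proof. by move=> bu bv; rewrite -rp_addE. Qed.

Lemma vprojZ (a : R) u : bounded_vec u -> vproj (vscale a u) = a *: vproj u :> Z.
Proof. by move=> bu; rewrite -rp_scaleE. Qed.

Lemma rp_normD y z : rp_norm (y + z) <= rp_norm y + rp_norm z.
Proof.
elim/rp_ind: y => u bu; elim/rp_ind: z => v bv.
rewrite -vprojD// !rp_normE//; last exact: bounded_vadd.
by apply: pseudo_normD => // d i; exact: ler_normD.
Qed.

Lemma rp_normZ (a : R) z : rp_norm (a *: z) = `|a| * rp_norm z.
Proof.
elim/rp_ind: z => u bu; rewrite -vprojZ// !rp_normE//; last exact: boundedZ.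
exact: pseudo_normZ.
Qed.

Lemma rp_norm0_eq0 z : rp_norm z = 0 -> z = 0.
Proof.
elim/rp_ind: z => u bu; rewrite rp_normE// => /(pseudo_norm_null bu) un.
apply: vproj_eq => //; first exact: bounded0.
by apply: null_le1 un => d i; rewrite /vsub subr0.
Qed.

HB.instance Definition _ := Lmodule_isNormed.Build R Z rp_normD rp_normZ rp_norm0_eq0.

Lemma vproj_normE u : bounded_vec u -> `|vproj u : Z| = pseudo_norm u.
Proof. by move=> bu; rewrite -rp_normE. Qed.

Lemma vproj_normB u v : bounded_vec u -> bounded_vec v ->
  `|(vproj u : Z) - vproj v| = pseudo_norm (vsub u v).
Proof.
move=> bu bv; rewrite -scaleN1r -vprojZ// -vprojD//; last exact: boundedZ.
rewrite vproj_normE; last by apply: bounded_vadd => //; exact: boundedZ.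
by congr pseudo_norm; apply/funext => d; apply/funext => i; rewrite /vadd /vscale mulN1r.
Qed.

Section Diagonal.
Variables (v : nat -> pvec P) (eps : nat -> R).
Hypotheses (bv : forall k, bounded_vec (v k)) (eps0 : forall k, 0 < eps k).
Hypothesis eps_half : forall k, eps k.+1 = eps k / 2.
Hypothesis v_step : forall k, ebound (vsub (v k.+1) (v k)) (eps k).

Let A k := [set d | bound_at d (vsub (v k.+1) (v k) d) (eps k)]%classic.

(** The first step whose estimate fails at [d], capped by the rank of [d]. The cap keeps it finite,
    and as ranks tend to infinity it eventually exceeds every [k]. *)
Let kappa d := find (fun j => ~~ `[< A j d >]) (iota 0 (pd_rank d)).

Let kappaA d j : (j < kappa d)%N -> A j d.
Proof.
move=> jk; have := before_find 0%N jk.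
have jr : (j < pd_rank d)%N.
  apply: leq_trans jk _; have := find_size (fun j => ~~ `[< A j d >]) (iota 0 (pd_rank d)).
  by rewrite size_iota.
by rewrite nth_iota// add0n => /negbFE/asboolP.
Qed.

Let kappa_ge d k : (k <= pd_rank d)%N -> (forall j, (j < k)%N -> A j d) -> (k <= kappa d)%N.
Proof.
move=> kr h; rewrite leqNgt; apply/negP => lt.
have ht : has (fun j => ~~ `[< A j d >]) (iota 0 (pd_rank d)).
  by rewrite has_find size_iota; exact: leq_trans lt kr.
have := nth_find 0%N ht; rewrite nth_iota ?add0n; last exact: leq_trans lt kr.
by move/asboolP; apply; exact: h.
Qed.

Definition diag_vec : pvec P := fun d => v (kappa d) d.

Lemma diag_vec_bound k : ebound (vsub diag_vec (v k)) (2 * eps k).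
Proof.
have : pd_filter [set d | forall j : 'I_k, A j d]%classic.
  by apply: filter_forall => j; exact: v_step.
move=> /(filterI (@pd_rank_cvg R P k)); apply: filterS => d /= [kr kA].
have kk : (k <= kappa d)%N by apply: kappa_ge => // j jk; exact: (kA (Ordinal jk)).
(* Halving steps sum exactly: [eps k + ... + eps (k + t - 1) = 2 * eps k - 2 * eps (k + t)]. *)
have tele t : (forall j, (k <= j < k + t)%N -> A j d) ->
    bound_at d (vsub (v (k + t)%N) (v k) d) (2 * eps k - 2 * eps (k + t)%N).
  elim: t => [|t IH] h.
    rewrite addn0 subrr => b b01; rewrite mul0r big1// => i _.
    by rewrite /vsub subrr normr0 mulr0.
  have h1 : A (k + t)%N d by apply: h; rewrite leq_addr/= ltn_add2l ltnSn.
  have h2 : bound_at d (vsub (v (k + t)%N) (v k) d) (2 * eps k - 2 * eps (k + t)%N).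
    by apply: IH => j /andP[kj jt]; apply: h; rewrite kj addnS ltnS ltnW.
  rewrite addnS eps_half.
  have -> : 2 * eps k - 2 * (eps (k + t)%N / 2) =
      eps (k + t)%N + (2 * eps k - 2 * eps (k + t)%N) by field.
  apply: bound_atD h1 h2 => i _.
  by rewrite /vsub -(subrKA (v (k + t)%N d i)) ler_normD.
have := tele (kappa d - k)%N; rewrite subnKC// => h.
apply: bound_atW (h _); first by rewrite lerBlDr lerDl mulr_ge0// ltW.
by move=> j /andP[_ jk]; exact: kappaA.
Qed.

Lemma diag_vec_bounded : bounded_vec diag_vec.
Proof.
apply: (@boundedD _ _ (vsub diag_vec (v 0%N)) (v 0%N)) => //.
  by move=> d i; rewrite -{1}(subrK (v 0%N d i) (diag_vec d i)) ler_normD.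
by exists (2 * eps 0%N); [rewrite mulr_ge0// ltW|exact: diag_vec_bound].
Qed.

End Diagonal.

Lemma rp_complete (F : set_system Z) : ProperFilter F -> cauchy F -> cvg F.
Proof.
move=> FF /cauchyP Fc.
have sum5 (t : R) : 2 * (2 * t) + t = 5 * t by ring.
have lt2 (a b t : R) : 0 < t -> a < t / 2 -> b < t -> a + b < 2 * t by lra.
pose e (k : nat) : R := 2^-1 ^+ k.
have e0 k : 0 < e k by rewrite exprn_gt0.
have eS k : e k.+1 = e k / 2 by rewrite /e exprSr.
have /choice[z zF] k : exists z : Z, F (ball z (e k)) by exact: Fc.
pose v k := vrepr (z k); have bv k : bounded_vec (v k) := vrepr_bounded (z k).
have vz k : vproj (v k) = z k := vreprK (z k).
have step k : ebound (vsub (v k.+1) (v k)) (2 * e k).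
  apply: pseudo_norm_lt; first exact: bounded_vsub.
  rewrite -vproj_normB// !vz.
  have [y []] := filter_ex (filterI (zF k.+1) (zF k)).
  rewrite -ball_normE /= => h1 h2.
  apply: le_lt_trans (ler_distD y _ _) _; rewrite [`|y - _|]distrC.
  by apply: lt2 => //; rewrite -eS.
have e20 k : 0 < 2 * e k by rewrite mulr_gt0.
have e2S k : 2 * e k.+1 = 2 * e k / 2 by rewrite eS mulrA.
have bw := diag_vec_bounded bv e20 e2S step.
have wb := diag_vec_bound e20 e2S step.
set w := diag_vec v _ in bw wb.
apply/cvg_ex; exists (vproj w : Z); apply/cvgrPdist_le => eps eps0.
(* The diagonal vector is within [4 * e k] of [z k], and the ball around [z k] adds [e k]. *)
have [k ke] : exists k, 5 * e k <= eps.
  have /archi_boundP : 0 <= 5 / eps by rewrite divr_ge0// ltW.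
  set k := Num.Def.archi_bound _ => kb; exists k.
  rewrite ltr_pdivrMr// in kb; rewrite /e exprVn ler_pdivrMr ?exprn_gt0//.
  apply: ltW; apply: lt_le_trans kb _; rewrite mulrC; apply: ler_wpM2l; first exact: ltW.
  by rewrite -natrX ler_nat ltnW// ltn_expl.
apply: filterS (zF k) => y; rewrite -ball_normE/= => zy.
apply: le_trans (ler_distD (z k) _ _) _; apply: le_trans ke.
have : `|(vproj w : Z) - z k| <= 2 * (2 * e k).
  rewrite -vz vproj_normB//; apply: pseudo_norm_le; last exact: wb.
  by rewrite mulr_ge0// ltW.
by rewrite -sum5 => /lerD; apply; exact: ltW.
Qed.

HB.instance Definition _ := Uniform_isComplete.Build Z rp_complete.

End ReducedProductStructure.

(** * Order structure of the quotient *)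

Section ReducedProductLattice.
Variables (R : realType) (P : prod_data R).
Notation Z := (rp_type P).
Implicit Types (x y z : Z).

(** Defined from the supremum, so that the order axioms become equations checked on
    representatives. *)
Let le y z := rp_sup y z = z.

Let supC x y : rp_sup x y = rp_sup y x.
Proof.
elim/rp_ind: x => u bu; elim/rp_ind: y => v bv; rewrite !rp_supE//.
by congr vproj; apply/funext => d; apply/funext => i; exact: maxC.
Qed.

Let supA x y z : rp_sup x (rp_sup y z) = rp_sup (rp_sup x y) z.
Proof.
elim/rp_ind: x => u bu; elim/rp_ind: y => v bv; elim/rp_ind: z => w bw.
have buv := bounded_vmax bu bv; have bvw := bounded_vmax bv bw.
by rewrite !rp_supE//; congr vproj; apply/funext => d; apply/funext => i; exact: maxA.
Qed.

Let supxx x : rp_sup x x = x.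
Proof.
elim/rp_ind: x => u bu; rewrite !rp_supE//.
by congr vproj; apply/funext => d; apply/funext => i; exact: maxxx.
Qed.

Let sup_add x y z : rp_sup (x + z) (y + z) = rp_sup x y + z.
Proof.
elim/rp_ind: x => u bu; elim/rp_ind: y => v bv; elim/rp_ind: z => w bw.
have buw := bounded_vadd bu bw; have bvw := bounded_vadd bv bw.
have buv := bounded_vmax bu bv.
rewrite (rp_supE bu bv) -!vprojD// rp_supE//.
by congr vproj; apply/funext => d; apply/funext => i; rewrite /vmax /vadd addr_maxl.
Qed.

Let sup_scale (a : R) x y : 0 <= a -> rp_sup (a *: x) (a *: y) = a *: rp_sup x y.
Proof.
move=> a0; elim/rp_ind: x => u bu; elim/rp_ind: y => v bv.
have bau := boundedZ a bu; have bav := boundedZ a bv; have buv := bounded_vmax bu bv.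
rewrite (rp_supE bu bv) -!vprojZ// rp_supE//.
by congr vproj; apply/funext => d; apply/funext => i; rewrite /vmax /vscale maxr_pMr.
Qed.

Let le_anti x y : le x y -> le y x -> x = y.
Proof. by rewrite /le => <-; rewrite supC supA supxx. Qed.

Let le_trans' x y z : le x y -> le y z -> le x z.
Proof. by rewrite /le => xy <-; rewrite supA xy. Qed.

Let le_add x y z : le x y -> le (x + z) (y + z).
Proof. by rewrite /le sup_add => ->. Qed.

Let le_scale (a : R) x y : 0 <= a -> le x y -> le (a *: x) (a *: y).
Proof. by move=> a0; rewrite /le sup_scale// => ->. Qed.

Let sup_ubl x y : le x (rp_sup x y). Proof. by rewrite /le supA supxx. Qed.
Let sup_ubr x y : le y (rp_sup x y). Proof. by rewrite supC; exact: sup_ubl. Qed.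
Let sup_least x y z : le x z -> le y z -> le (rp_sup x y) z.
Proof. by rewrite /le => xz yz; rewrite -supA yz. Qed.

Let vneg (u : pvec P) := vscale (-1) u.

Let vprojN (u : pvec P) : bounded_vec u -> - (vproj u : Z) = vproj (vneg u).
Proof. by move=> bu; rewrite /vneg vprojZ// scaleN1r. Qed.

Let absE (u : pvec P) : bounded_vec u ->
  rp_sup (vproj u) (- (vproj u : Z)) = vproj (fun d i => `|u d i|).
Proof.
move=> bu; have bnu := boundedZ (-1) bu; rewrite vprojN// rp_supE//.
congr vproj; apply/funext => d; apply/funext => i; rewrite /vmax /vneg /vscale mulN1r.
by have [h|h] := leP 0 (u d i); [rewrite ger0_norm//; apply/max_idPl|
  rewrite ltr0_norm//; apply/max_idPr]; lra.
Qed.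

Let bounded_abs (u : pvec P) : bounded_vec u -> bounded_vec (fun d i => `|u d i|).
Proof.
move=> bu; apply: boundedD bu (bounded0 P) => d i.
by rewrite normr_id normr0 addr0.
Qed.

Let abs_norm x y : le (rp_sup x (- x)) (rp_sup y (- y)) -> `|x| <= `|y|.
Proof.
elim/rp_ind: x => u bu; elim/rp_ind: y => v bv; rewrite /le !absE//.
have bu' := bounded_abs bu; have bv' := bounded_abs bv; have bm := bounded_vmax bu' bv'.
rewrite rp_supE// => /(vproj_null bm bv') h.
rewrite !vproj_normE// -[leRHS]add0r -(null_pseudo_norm h).
apply: pseudo_normD => // [d i|]; last exact: bounded_vsub.
rewrite /vsub /vmax [X in _ <= X + _]ger0_norm; last by rewrite subr_ge0 le_max lexx orbT.
by rewrite subrK le_max lexx.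
Qed.

Definition rp_lattice : BanachLattice R :=
  @Build_BanachLattice R Z le (@rp_sup R P) supxx le_anti le_trans' le_add le_scale
    sup_ubl sup_ubr sup_least abs_norm.

Definition rp_proj : pvec P -> rp_lattice := @vproj R P.

Lemma rp_projD u v : bounded_vec u -> bounded_vec v ->
  rp_proj (vadd u v) = rp_proj u + rp_proj v.
Proof. exact: vprojD. Qed.

Lemma rp_projZ (a : R) u : bounded_vec u -> rp_proj (vscale a u) = a *: rp_proj u.
Proof. exact: vprojZ. Qed.

Lemma rp_proj_sup u v : bounded_vec u -> bounded_vec v ->
  rp_proj (vmax u v) = bsup (rp_proj u) (rp_proj v).
Proof. by move=> bu bv; rewrite /= rp_supE. Qed.

Lemma rp_proj_norm u : bounded_vec u -> `|rp_proj u| = pseudo_norm u.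
Proof. exact: vproj_normE. Qed.

Lemma rp_proj_surj (z : rp_lattice) : exists2 u, bounded_vec u & z = rp_proj u.
Proof. by exists (vrepr z); [exact: vrepr_bounded|rewrite /rp_proj vreprK]. Qed.

(** Agreement on a set of the filter is enough; thus forms exact on finitely many elements at a time
    yield true lattice identities. *)
Lemma rp_proj_near u v : bounded_vec u -> bounded_vec v ->
  pd_filter [set d | forall i, (i < pd_size d)%N -> u d i = v d i]%classic ->
  rp_proj u = rp_proj v.
Proof.
move=> bu bv uv; apply: vproj_eq => // r r0; apply: filterS uv => d /= uv b b01.
rewrite big1; first by rewrite mulr_ge0 ?gauge_ge0// ltW.
by move=> i _; rewrite /vsub uv// subrr normr0 mulr0.
Qed.

Lemma rp_proj_le u v : bounded_vec u -> bounded_vec v -> (forall d i, u d i <= v d i) ->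
  ble (rp_proj u) (rp_proj v).
Proof.
move=> bu bv uv; rewrite /= /le rp_supE//.
by congr vproj; apply/funext => d; apply/funext => i; apply/max_idPr.
Qed.

Lemma rp_proj_disjoint u v : bounded_vec u -> bounded_vec v ->
  binf (babs (rp_proj u)) (babs (rp_proj v)) = 0 ->
  null_vec (fun d i => Num.min `|u d i| `|v d i|).
Proof.
move=> bu bv; rewrite /babs /binf /= !absE//.
have bu' := boundedZ (-1) (bounded_abs bu); have bv' := boundedZ (-1) (bounded_abs bv).
have bm := bounded_vmax bu' bv'; have bm' := boundedZ (-1) bm.
rewrite (vprojN (bounded_abs bu)) (vprojN (bounded_abs bv)) rp_supE// vprojN//.
move=> /(vproj_null bm' (bounded0 P)); apply: null_le1 => d i.
rewrite /vsub /vscale /vmax subr0 !mulN1r normrN.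
have [h|h] := leP `|u d i| `|v d i|.
  by rewrite (_ : Num.max _ _ = - `|u d i|) ?normrN//; apply/max_idPl; rewrite lerN2.
by rewrite (_ : Num.max _ _ = - `|v d i|) ?normrN//; apply/max_idPr; rewrite lerN2 ltW.
Qed.

Lemma rp_proj_sum (I : Type) (s : seq I) (u : I -> pvec P) :
  (forall k, bounded_vec (u k)) ->
  bounded_vec (fun d i => \sum_(k <- s) u k d i) /\
  rp_proj (fun d i => \sum_(k <- s) u k d i) = \sum_(k <- s) rp_proj (u k).
Proof.
move=> bu; elim: s => [|k s [bs IH]].
  have e : (fun d i => \sum_(k <- [::]) u k d i) = (fun _ _ => 0) :> pvec P.
    by apply/funext => d; apply/funext => i; rewrite big_nil.
  by rewrite e big_nil; split; [exact: bounded0|].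
have e : (fun d i => \sum_(j <- k :: s) u j d i) =
    vadd (u k) (fun d i => \sum_(j <- s) u j d i) :> pvec P.
  by apply/funext => d; apply/funext => i; rewrite big_cons.
rewrite e big_cons; split; first exact: bounded_vadd.
by rewrite rp_projD// IH.
Qed.

Lemma null_sum (I : Type) (s : seq I) (Q : pred I) (u : I -> pvec P) :
  (forall k, Q k -> null_vec (u k)) -> null_vec (fun d i => \sum_(k <- s | Q k) u k d i).
Proof.
move=> nu; elim: s => [|k s IH].
  by apply: null_le1 (null0 P) => d i; rewrite big_nil.
have [Qk|Qk] := boolP (Q k); last first.
  by apply: null_le1 IH => d i; rewrite big_cons (negbTE Qk).
by apply: null_le (nu _ Qk) IH => d i; rewrite big_cons Qk ler_normD.
Qed.

End ReducedProductLattice.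

(** * Membership of the reduced product in the two classes *)

Section ReducedProductClass.
Variables (R : realType) (P : prod_data R) (p q : R).
Hypotheses (p_gt1 : 1 < p) (qE : q = p / (p - 1)).
Hypothesis weight_ge0 : forall (d : pd_index P) i, 0 <= pd_weight d i.
Hypotheses (exp_ge1 : 1 <= pd_exp P) (rootE : pd_root P = q^-1).
Notation s := (pd_exp P).

Let q0 : 0 < q. Proof. by have := conj_exp_gt1 p_gt1 qE; lra. Qed.
Let s0 : 0 <= s. Proof. by move: exp_ge1; lra. Qed.

Section Convexity.
Variables (L : nat) (v : 'I_L -> pvec P) (w : pvec P).
Hypothesis bv : forall k, bounded_vec (v k).
Hypothesis wv : forall d i, exists a : 'I_L -> R,
  [/\ forall k, 0 <= a k <= 1, \sum_k a k `^ s <= 1 & `|w d i| <= \sum_k a k * `|v k d i|].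

Let C := (\sum_k pseudo_norm (v k) `^ p) `^ p^-1.

Lemma ebound_convex (eps : R) : 0 < eps -> ebound w (C + L%:R * eps).
Proof.
move=> e0; have : pd_filter
    [set d | forall k, bound_at d (v k d) (pseudo_norm (v k) + eps)]%classic.
  apply: filter_forall => k; apply: (pseudo_norm_lt (bv k)).
  by rewrite ltrDl.
apply: filterS => d /= h b b01; have /choice[a aP] := wv d.
have a01 i k : 0 <= a i k <= 1 by case: (aP i).
pose ba k i := b i * a i k.
have ba01 k i : 0 <= ba k i <= 1.
  have /andP[? ?] := b01 i; have /andP[? ?] := a01 i k.
  by rewrite mulr_ge0//= -[1]mulr1; apply: ler_pM.
have g_le k : gauge d (ba k) <= gauge d b.
  rewrite /gauge rootE; apply: powR_le; first by rewrite invr_ge0 ltW.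
    by apply: sumr_ge0 => i _; rewrite mulr_ge0// powR_ge0.
  apply: ler_sum => i _; apply: ler_wpM2r => //; apply: powR_le => //.
    by case/andP: (ba01 k i).
  have /andP[? ?] := b01 i; have /andP[? ?] := a01 i k.
  by rewrite -[leRHS]mulr1; apply: ler_wpM2l.
have g_sum : (\sum_k gauge d (ba k) `^ q) `^ q^-1 <= gauge d b.
  rewrite {2}/gauge rootE; apply: powR_le; first by rewrite invr_ge0 ltW.
    by apply: sumr_ge0 => k _; exact: powR_ge0.
  have -> : \sum_k gauge d (ba k) `^ q =
      \sum_k \sum_(i < pd_size d) (b i `^ s * pd_weight d i) * a i k `^ s.
    apply: eq_bigr => k _; rewrite /gauge rootE powRK//; last first.
      by apply: sumr_ge0 => i _; rewrite mulr_ge0// powR_ge0.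
    apply: eq_bigr => i _; have /andP[? _] := b01 i; have /andP[? _] := a01 i k.
    by rewrite powRM// mulrAC.
  rewrite exchange_big/=; apply: ler_sum => i _; rewrite -mulr_sumr.
  rewrite -[leRHS]mulr1; apply: ler_wpM2l; first by rewrite mulr_ge0// powR_ge0.
  by case: (aP i).
apply: (@le_trans _ _ (\sum_k (pseudo_norm (v k) + eps) * gauge d (ba k))).
  apply: (@le_trans _ _ (\sum_k \sum_(i < pd_size d) ba k i * `|v k d i|)).
    rewrite exchange_big/=; apply: ler_sum => i _.
    under eq_bigr do rewrite /ba -mulrA.
    rewrite -mulr_sumr; apply: ler_wpM2l; first by case/andP: (b01 i).
    by case: (aP i).
  by apply: ler_sum => k _; exact: h.
under eq_bigr do rewrite mulrDl.
rewrite big_split mulrDl /=; apply: lerD.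
  apply: le_trans (hoelder_seq p_gt1 qE _ _ _) _.
  - by move=> k; exact: pseudo_norm_ge0.
  - by move=> k; exact: gauge_ge0.
  - by apply: ler_wpM2l => //; exact: powR_ge0.
rewrite -mulrA mulr_natl -[X in _ *+ X](card_ord L) -sumr_const.
by apply: ler_sum => k _; apply: ler_wpM2l => //; exact: ltW.
Qed.

Lemma bounded_convex : bounded_vec w.
Proof.
exists (C + L%:R * 1); last exact: ebound_convex.
by rewrite addr_ge0// ?powR_ge0// mulr1.
Qed.

Lemma norm_convex : pseudo_norm w <= C.
Proof.
apply/ler_addgt0Pl => eps e0; have L0 : 0 < L%:R + 1 :> R by rewrite ltr_wpDl.
have := ebound_convex (divr_gt0 e0 L0) => h.
have d0 : 0 <= eps / (L%:R + 1) by rewrite divr_ge0// ltW.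
apply: le_trans (pseudo_norm_le _ h) _; first by rewrite addr_ge0 ?powR_ge0// mulr_ge0.
rewrite addrC lerD2r mulrCA -[leRHS]mulr1; apply: ler_wpM2l; first exact: ltW.
by rewrite ler_pdivrMr// mul1r lerDl.
Qed.

End Convexity.

(** The equality case of Hoelder: [a k = (|y k| / S)^(p-1)] with [S] the [l_p] norm of [y], and
    [(p - 1) * q = p]. *)
Lemma dual_pnorm (L : nat) (y : 'I_L -> R) : exists a : 'I_L -> R,
  [/\ forall k, 0 <= a k <= 1, \sum_k a k `^ q <= 1 &
      (\sum_k `|y k| `^ p) `^ p^-1 <= \sum_k a k * `|y k|].
Proof.
have p0 : 0 < p by move: p_gt1; lra.
set Y := \sum_k _; have Y0 : 0 <= Y by apply: sumr_ge0 => k _; exact: powR_ge0.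
have [Yz|Yn] := eqVneq Y 0.
  exists (fun=> 0); split=> [k||]; first by rewrite lexx ler01.
    by rewrite big1// => k _; rewrite powR0// gt_eqF.
  by rewrite Yz powR0 ?invr_neq0 ?gt_eqF// big1// => k _; rewrite mul0r.
have Yp : 0 < Y by rewrite lt0r Yn.
set S := Y `^ p^-1; have S0 : 0 < S by rewrite powR_gt0.
have SY : S `^ p = Y by rewrite powRK.
have yS k : `|y k| <= S.
  rewrite -[leLHS](powRVK (r := p))//; apply: powR_le; rewrite ?invr_ge0 ?(ltW p0) ?powR_ge0//.
  by rewrite /Y (bigD1 k)//= lerDl; apply: sumr_ge0 => j _; exact: powR_ge0.
have p1 : 0 <= p - 1 by move: p_gt1; lra.
have yS0 k : 0 <= `|y k| / S by rewrite divr_ge0// ltW.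
exists (fun k => (`|y k| / S) `^ (p - 1)); split.
- move=> k; rewrite powR_ge0/=.
  have := @powR_le R (`|y k| / S) 1 (p - 1) p1 (yS0 k); rewrite powR1; apply.
  by rewrite ler_pdivrMr// mul1r.
- have e k : ((`|y k| / S) `^ (p - 1)) `^ q = `|y k| `^ p / Y.
    rewrite -powRrM (_ : (p - 1) * q = p); last first.
      by rewrite qE mulrC divfK// gt_eqF// subr_gt0.
    by rewrite powRM ?invr_ge0 ?(ltW S0)// -powR_inv1 ?(ltW S0)// powRAC SY powR_inv1.
  by under eq_bigr do rewrite e; rewrite -mulr_suml mulfV.
- have e k : (`|y k| / S) `^ (p - 1) * `|y k| = S * (`|y k| `^ p / Y).
    have [r r0 ->] : exists2 r, 0 <= r & `|y k| = S * r.
      by exists (`|y k| / S) => //; rewrite mulrC divfK// gt_eqF.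
    have -> : S * r / S = r by rewrite mulrAC mulfV ?mul1r// gt_eqF.
    have -> : r `^ (p - 1) * (S * r) = S * (r * r `^ (p - 1)).
      by move: (r `^ _) => *; ring.
    rewrite mulr_powRB1// powRM ?(ltW S0)// SY; congr (_ * _).
    by rewrite mulrAC mulfV ?mul1r.
  by under eq_bigr do rewrite e; rewrite -mulr_sumr -mulr_suml mulfV// mulr1.
Qed.

(** The class of the coordinatewise [l_p] sum [w] is an upper bound of the combinations; as [z] is
    the least one, [0 <= z <= w] transfers the norm estimate. *)
Lemma rp_in_Cp : s = q -> in_Cp p (rp_lattice P).
Proof.
move=> sq L x z [zub zleast].
have /choice[v vP] k : exists u, bounded_vec u /\ x k = rp_proj u.
  by have [u bu xE] := rp_proj_surj (x k); exists u.
have bv k : bounded_vec (v k) by case: (vP k).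
have xE k : x k = rp_proj (v k) by case: (vP k).
pose w : pvec P := fun d i => (\sum_k `|v k d i| `^ p) `^ p^-1.
have wv d i : exists a : 'I_L -> R,
  [/\ forall k, 0 <= a k <= 1, \sum_k a k `^ s <= 1 & `|w d i| <= \sum_k a k * `|v k d i|].
  by rewrite ger0_norm ?powR_ge0// sq; exact: dual_pnorm.
have bw := bounded_convex bv wv.
have wub y : (exists a : 'I_L -> R, \sum_(k < L) `|a k| `^ (p / (p - 1)) <= 1 /\
    y = \sum_(k < L) a k *: x k) -> ble y (rp_proj w).
  move=> [a [a1 ->]].
  have bav k : bounded_vec (vscale (a k) (v k)) by exact: boundedZ.
  have [bs sE] := rp_proj_sum (index_enum 'I_L) bav.
  have -> : \sum_(k < L) a k *: x k = rp_proj (fun d i => \sum_k vscale (a k) (v k) d i).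
    by rewrite sE; apply: eq_bigr => k _; rewrite rp_projZ// xE.
  apply: rp_proj_le => // d i; rewrite /vscale.
  apply: (@le_trans _ _ (\sum_k `|v k d i| * `|a k|)).
    by apply: ler_sum => k _; rewrite mulrC -normrM ler_norm.
  apply: le_trans (hoelder_seq p_gt1 qE _ _ _) _ => //.
  rewrite -[leRHS]mulr1; apply: ler_wpM2l; first exact: powR_ge0.
  have := @powR_le R (\sum_k `|a k| `^ q) 1 q^-1; rewrite powR1; apply.
  - by rewrite invr_ge0 ltW.
  - by apply: sumr_ge0 => k _; exact: powR_ge0.
  - by rewrite qE.
have z0 : ble 0 z.
  apply: zub; exists (fun=> 0); rewrite !big1// => k _; first by rewrite scale0r.
  by rewrite normr0 powR0// -qE gt_eqF.
apply: le_trans (bnorm_le z0 (zleast _ wub)) _.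
rewrite rp_proj_norm//; apply: le_trans (norm_convex bv wv) _.
by under eq_bigr do rewrite -rp_proj_norm// -xE.
Qed.

(** [a] is the indicator of a largest entry; any other entry equals its minimum with that one and is
    absorbed by the last sum, which measures the failure of disjointness. *)
Lemma abs_sum_max (L : nat) (y : 'I_L -> R) : exists a : 'I_L -> R,
  [/\ forall k, 0 <= a k <= 1, \sum_k a k <= 1 &
    `|\sum_k y k| <= \sum_k a k * `|y k| +
      \sum_k \sum_(j | j != k) Num.min `|y k| `|y j|].
Proof.
case: L y => [|L] y.
  exists (fun=> 0); split=> [[]//||]; first by rewrite big_ord0.
  by rewrite !big_ord0 normr0 addr0.
have [m ym] : exists m, forall k, `|y k| <= `|y m|.
  by exists [arg max_(m > ord0) `|y m|]%O; case: arg_maxP => // m _ h k; exact: h.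
exists (fun k => (k == m)%:R); split=> [k||].
- by case: (k == m); rewrite ?lexx ?ler01.
- by rewrite (bigD1 m)//= eqxx big1 ?addr0// => k /negbTE->.
apply: le_trans (ler_norm_sum _ _ _) _.
rewrite (bigD1 m)//= [X in _ <= X + _](bigD1 m)//= eqxx mul1r.
rewrite [X in _ <= _ + X + _]big1 ?addr0; last by move=> k /negbTE->; rewrite mul0r.
rewrite lerD2l [leRHS](bigD1 m)//= ler_wpDl//.
  by apply: sumr_ge0 => k _; rewrite le_min !normr_ge0.
apply: ler_sum => k km; rewrite (bigD1 m) 1?eq_sym//= (min_idPl (ym k)) lerDl.
by apply: sumr_ge0 => j _; rewrite le_min !normr_ge0.
Qed.

Lemma rp_in_Cpinf : s = 1 -> in_Cpinf p (rp_lattice P).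
Proof.
move=> s1 L x xdisj.
have /choice[v vP] k : exists u, bounded_vec u /\ x k = rp_proj u.
  by have [u bu xE] := rp_proj_surj (x k); exists u.
have bv k : bounded_vec (v k) by case: (vP k).
have xE k : x k = rp_proj (v k) by case: (vP k).
pose E : pvec P := fun d i => \sum_k \sum_(j | j != k) Num.min `|v k d i| `|v j d i|.
have E0 d i : 0 <= E d i.
  by apply: sumr_ge0 => k _; apply: sumr_ge0 => j _; rewrite le_min !normr_ge0.
have nE : null_vec E.
  apply: (@null_sum R P _ _ xpredT
    (fun k d i => \sum_(j | j != k) Num.min `|v k d i| `|v j d i|)) => k _.
  apply: (@null_sum R P _ _ (fun j => j != k)
    (fun j d i => Num.min `|v k d i| `|v j d i|)) => j jk.
  by apply: rp_proj_disjoint => //; rewrite -!xE; apply: xdisj; rewrite eq_sym.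
have bE : bounded_vec E by exists 1 => //; exact: nE.
(* Representatives of disjoint classes overlap by the null vector [E]; once it is subtracted, with
   truncation at [0], the convexity estimate applies. *)
pose w : pvec P := fun d i => Num.max 0 (`|\sum_k v k d i| - E d i).
have wv d i : exists a : 'I_L -> R,
  [/\ forall k, 0 <= a k <= 1, \sum_k a k `^ s <= 1 & `|w d i| <= \sum_k a k * `|v k d i|].
  have [a [a01 a1 ha]] := abs_sum_max (fun k => v k d i); exists a; split=> //.
    apply: le_trans a1; rewrite s1; apply: ler_sum => k _.
    by case/andP: (a01 k) => a0 _; rewrite powRr1.
  rewrite ger0_norm ?le_max ?lexx// ge_max lerBlDr ha andbT.
  by apply: sumr_ge0 => k _; rewrite mulr_ge0//; case/andP: (a01 k).
have bw := bounded_convex bv wv.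
have [bs sE] := rp_proj_sum (index_enum 'I_L) bv.
have -> : \sum_(k < L) x k = rp_proj (fun d i => \sum_k v k d i).
  by rewrite sE; apply: eq_bigr => k _; rewrite xE.
rewrite rp_proj_norm//; under eq_bigr do rewrite xE rp_proj_norm//.
apply: le_trans (norm_convex bv wv); rewrite -[leRHS]addr0 -[X in _ <= _ + X](null_pseudo_norm nE).
apply: pseudo_normD => // d i.
rewrite (ger0_norm (E0 d i)) -lerBlDr; apply: le_trans (ler_norm _).
by rewrite /= /w le_max lexx orbT.
Qed.

End ReducedProductClass.

(** * Amalgamation *)

Section LatticeHom.
Variables (R : realType) (W X : BanachLattice R) (T : W -> X).
Hypothesis hT : lattice_hom T.

Lemma lattice_hom_bpos w : T (bpos w) = bpos (T w).
Proof.
case: hT => _ [TZ TS]; rewrite /bpos TS.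
by have := TZ 0 0; rewrite !scale0r => ->.
Qed.

Lemma lattice_hom_ge0 w : ble 0 w -> ble 0 (T w).
Proof. by move=> w0; rewrite -(bpos_id w0) lattice_hom_bpos; exact: bpos_ge0. Qed.

Lemma pos_form_comp (f : X -> R) : pos_form f -> pos_form (f \o T).
Proof.
move=> pf; case: (hT) => TD [TZ _]; split; last first.
  by move=> w w0; exact: (pos_form_ge0 pf (lattice_hom_ge0 w0)).
by split=> [u v|a u] /=; rewrite ?TD ?TZ ?(pos_formD pf) ?(pos_formZ pf).
Qed.

(** Domination on positive elements suffices: [lam w <= lam (w^+) <= N (T (w^+)) = N ((T w)^+)]. *)
Lemma pos_form_extension (lam : W -> R) (N : X -> R) : pos_form lam ->
  sublinear (fun u => N (bpos u)) -> (forall w, ble 0 w -> lam w <= N (T w)) ->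
  exists h, [/\ pos_form h, (forall u, h u <= N (bpos u)) & forall w, h (T w) = lam w].
Proof.
move=> pl sN lN; case: (hT) => TD [TZ _].
have [w|h [lh hN hT']] := hahn_banach_ext sN TD TZ pl.1.
  apply: le_trans (pos_form_le pl (ble_bpos w)) _.
  by rewrite -lattice_hom_bpos; apply: lN; exact: bpos_ge0.
exists h; split=> //; apply: (le_bpos_pos_form lh _ hN).
by have := sublinear0 sN; rewrite (bpos_id (ble_refl 0)).
Qed.

End LatticeHom.

(** * Compatible splittings and the amalgam *)

Section Amalgam.
Variables (R : realType) (p : R) (c : lattice_class) (X0 X1 X2 : BanachLattice R).
Variables (T1 : X0 -> X1) (T2 : X0 -> X2).
Hypotheses (p_gt1 : 1 < p) (XC1 : in_class c p X1) (XC2 : in_class c p X2).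
Hypotheses (hT1 : lattice_hom T1) (hT2 : lattice_hom T2).

Definition cell : Type := ((X1 -> R) * (X2 -> R))%type.

Definition compatible (e : cell) :=
  [/\ pos_form e.1, pos_form e.2 & forall w, e.1 (T1 w) = e.2 (T2 w)].

Definition cell_le (e' e : cell) :=
  (forall y, ble 0 y -> e'.1 y <= e.1 y) /\ (forall y, ble 0 y -> e'.2 y <= e.2 y).

Definition cell_exact (e : cell) (l : X1 + X2) :=
  match l with inl x => exact_on e.1 x | inr x => exact_on e.2 x end.

Lemma cell_exact_le e e' l : compatible e -> compatible e' -> cell_le e' e ->
  cell_exact e l -> cell_exact e' l.
Proof.
by move=> [p1 p2 _] [p1' p2' _] [l1 l2]; case: l => x /=; exact: exact_on_le.
Qed.

Lemma pos_form_lift (X : BanachLattice R) (T : X0 -> X) (f : X -> R) (lam : X0 -> R) :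
  lattice_hom T -> pos_form f -> pos_form lam ->
  (forall w, ble 0 w -> lam w <= f (T w)) ->
  exists g, [/\ pos_form g, (forall y, ble 0 y -> g y <= f y) & forall w, g (T w) = lam w].
Proof.
move=> hT pf pl lf.
have [g [pg gf gT]] := pos_form_extension hT pl (pos_form_bpos_sublinear pf) lf.
by exists g; split=> // y y0; have := gf y; rewrite bpos_id.
Qed.

Lemma cell_split e l : compatible e -> exists e' e'',
  [/\ compatible e' /\ compatible e'', cell_le e' e /\ cell_le e'' e,
      cell_exact e' l /\ cell_exact e'' l,
      forall y, e.1 y = e'.1 y + e''.1 y & forall y, e.2 y = e'.2 y + e''.2 y].
Proof.
move=> [p1 p2 eT]; case: l => x.
- have [g [h [pg ph gh gx hx]]] := pos_form_split x p1.
  have ge y : ble 0 y -> g y <= e.1 y by move=> y0; rewrite gh lerDl; exact: pos_form_ge0.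
  have he y : ble 0 y -> h y <= e.1 y by move=> y0; rewrite gh lerDr; exact: pos_form_ge0.
  have [k [pk ke kT]] := pos_form_lift hT2 p2 (pos_form_comp hT1 pg)
    (fun w w0 => le_trans (ge _ (lattice_hom_ge0 hT1 w0)) (eq_ind _ (<=%R _) (lexx _) _ (eT w))).
  exists (g, k), (h, fun y => e.2 y - k y).
  have pk' := pos_form_sub p2 pk ke.
  split=> //=; last by move=> y; rewrite addrC subrK.
  + by split; split=> //= w; rewrite ?kT//= -eT gh addrC addKr.
  + by split; split=> //= y /(pos_form_ge0 pk) k0; rewrite lerBlDr lerDl.
- have [g [h [pg ph gh gx hx]]] := pos_form_split x p2.
  have ge y : ble 0 y -> g y <= e.2 y by move=> y0; rewrite gh lerDl; exact: pos_form_ge0.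
  have he y : ble 0 y -> h y <= e.2 y by move=> y0; rewrite gh lerDr; exact: pos_form_ge0.
  have [k [pk ke kT]] := pos_form_lift hT1 p1 (pos_form_comp hT2 pg)
    (fun w w0 => le_trans (ge _ (lattice_hom_ge0 hT2 w0))
       (eq_ind _ (<=%R _) (lexx _) _ (esym (eT w)))).
  exists (k, g), (fun y => e.1 y - k y, h).
  have pk' := pos_form_sub p1 pk ke.
  split=> //=; last by move=> y; rewrite addrC subrK.
  + by split; split=> //= w; rewrite ?kT//= eT gh addrC addKr.
  + by split; split=> //= y /(pos_form_ge0 pk) k0; rewrite lerBlDr lerDl.
Qed.

Lemma cell_decomposition (L : seq (X1 + X2)) e : compatible e -> exists cs : seq cell,
  [/\ forall e', List.In e' cs ->
        [/\ compatible e', cell_le e' e & forall l, List.In l L -> cell_exact e' l],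
      forall y, \sum_(e' <- cs) e'.1 y = e.1 y & forall y, \sum_(e' <- cs) e'.2 y = e.2 y].
Proof.
elim: L e => [|l L IH] e ce.
  by exists [:: e]; split=> [e' [<-|//]|y|y]; rewrite ?big_seq1.
have [e1 [e2 [[c1 c2] [le1 le2] [x1 x2] s1 s2]]] := cell_split l ce.
have [cs1 [h1 f1 g1]] := IH _ c1; have [cs2 [h2 f2 g2]] := IH _ c2.
exists (cs1 ++ cs2); split=> [e' e'cs|y|y].
- have [/h1 [ce' le' x']|/h2 [ce' le' x']] := List.in_app_or _ _ _ e'cs; split=> //.
  + by split=> y y0; [apply: le_trans (le'.1 y y0) (le1.1 y y0)|
                      apply: le_trans (le'.2 y y0) (le1.2 y y0)].
  + by move=> l' [<-|/x'//]; exact: cell_exact_le c1 ce' le' x1.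
  + by split=> y y0; [apply: le_trans (le'.1 y y0) (le2.1 y y0)|
                      apply: le_trans (le'.2 y y0) (le2.2 y y0)].
  + by move=> l' [<-|/x'//]; exact: cell_exact_le c2 ce' le' x2.
- by rewrite big_cat f1 f2 s1.
- by rewrite big_cat g1 g2 s2.
Qed.

Variable e0 : cell.
Hypothesis ce0 : compatible e0.
Hypotheses (e0_norm1 : forall y, ble 0 y -> e0.1 y <= `|y|)
           (e0_norm2 : forall y, ble 0 y -> e0.2 y <= `|y|).

Let q := p / (p - 1).
Let s := class_exp c p.

(** The sum is recorded on the [X1] side, where the norm of [x] is read off. The rank is a free
    label, by which the filter can demand ranks tending to infinity. *)
Record datum := Datum {
  dt_cells : seq cell;
  dt_weight : nat -> R;
  dt_rank : nat;
  dt_compatible : forall i, (i < size dt_cells)%N -> compatible (nth e0 dt_cells i);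
  dt_sum : forall y, \sum_(i < size dt_cells) (nth e0 dt_cells i).1 y = e0.1 y;
  dt_weight_ge0 : forall i, 0 <= dt_weight i;
  dt_weight_le1 : \sum_(i < size dt_cells) dt_weight i <= 1;
  dt_bound1 : forall (b : nat -> R) (y : X1), (forall i, 0 <= b i <= 1) -> ble 0 y ->
    \sum_(i < size dt_cells) b i * (nth e0 dt_cells i).1 y <=
    K_class c p * `|y| * (\sum_(i < size dt_cells) b i `^ s * dt_weight i) `^ q^-1;
  dt_bound2 : forall (b : nat -> R) (y : X2), (forall i, 0 <= b i <= 1) -> ble 0 y ->
    \sum_(i < size dt_cells) b i * (nth e0 dt_cells i).2 y <=
    K_class c p * `|y| * (\sum_(i < size dt_cells) b i `^ s * dt_weight i) `^ q^-1
}.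

Definition datum_exact (d : datum) (l : X1 + X2) :=
  forall i, (i < size (dt_cells d))%N -> cell_exact (nth e0 (dt_cells d) i) l.

Let q0 : 0 < q. Proof. by have := conj_exp_gt1 p_gt1 erefl; rewrite -/q; lra. Qed.

Lemma In_nth (I : Type) (a : I) (t : seq I) (Q : I -> Prop) :
  (forall e, List.In e t -> Q e) -> forall i, (i < size t)%N -> Q (nth a t i).
Proof.
elim: t => [|e t IH] h [|i] //= it; first by apply: h; left.
by apply: IH => // e' et; apply: h; right.
Qed.

Lemma K_classE : K_class c p = 2 `^ q^-1 * (if c is ClassCp then 1 else gamma_p p).
Proof.
have -> : q^-1 = 1 - p^-1 by have := conj_expV p_gt1 erefl; rewrite -/q; lra.
by case: (c) => //=; rewrite mulr1.
Qed.

Lemma K_class_gt0 : 0 < K_class c p.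
Proof.
rewrite K_classE mulr_gt0 ?powR_gt0//; case: (c) => //.
by rewrite (gamma_pE p_gt1) powR_gt0.
Qed.

(* Halving the sum of the two families of weights costs the factor [2 `^ q^-1]. *)
Lemma average_bound (n : nat) (w w' : 'I_n -> R) (h : nat -> R) (b : nat -> R) (t A : R) :
  (forall i, 0 <= w i) -> (forall i, 0 <= w' i) -> (forall i : 'I_n, h i = (w i + w' i) / 2) ->
  0 <= t ->
  A <= (if c is ClassCp then 1 else gamma_p p) * t *
       (\sum_(i < n) b i `^ s * w i) `^ q^-1 ->
  A <= K_class c p * t * (\sum_(i < n) b i `^ s * h i) `^ q^-1.
Proof.
move=> w0 w'0 hE t0 /le_trans; apply; rewrite K_classE -!mulrA [leRHS]mulrCA.
pose k : R := if c is ClassCp then 1 else gamma_p p; rewrite -/k.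
have k0 : 0 <= k by rewrite /k; case: (c) => //; exact: powR_ge0.
apply: ler_wpM2l => //; rewrite [leRHS]mulrCA; apply: ler_wpM2l => //.
rewrite -powRM ?ler0n//; last first.
  by apply: sumr_ge0 => i _; rewrite mulr_ge0 ?powR_ge0// hE divr_ge0// addr_ge0.
apply: powR_le; first by rewrite invr_ge0 ltW.
  by apply: sumr_ge0 => i _; rewrite mulr_ge0// powR_ge0.
rewrite mulr_sumr; apply: ler_sum => i _; rewrite mulrCA; apply: ler_wpM2l.
  exact: powR_ge0.
by rewrite hE; have := w'0 i; lra.
Qed.

Lemma exists_datum (L : seq (X1 + X2)) (k : nat) : exists d : datum,
  (forall l, List.In l L -> datum_exact d l) /\ (k <= dt_rank d)%N.
Proof.
have [cs [csP s1 s2]] := cell_decomposition L ce0.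
have nthP := In_nth e0 csP.
have s1' y : \sum_(i < size cs) (nth e0 cs i).1 y = e0.1 y.
  by rewrite -s1 (big_nth e0) big_mkord.
have s2' y : \sum_(i < size cs) (nth e0 cs i).2 y = e0.2 y.
  by rewrite -s2 (big_nth e0) big_mkord.
have comp i : (i < size cs)%N -> compatible (nth e0 cs i) by move=> /nthP[].
have [w [w0 w1 wb]] : exists w : 'I_(size cs) -> R,
    [/\ forall i, 0 <= w i, \sum_i w i <= 1 & forall (b : 'I_(size cs) -> R) (x : X1),
     (forall i, 0 <= b i <= 1) -> ble 0 x ->
     \sum_i b i * (nth e0 cs i).1 x <= (if c is ClassCp then 1 else gamma_p p) * `|x| *
       (\sum_i b i `^ s * w i) `^ q^-1].
  apply: exists_weights => // [i|x x0]; first by case: (comp i (ltn_ord i)).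
  by rewrite s1'; exact: e0_norm1.
have [w' [w'0 w'1 w'b]] : exists w : 'I_(size cs) -> R,
    [/\ forall i, 0 <= w i, \sum_i w i <= 1 & forall (b : 'I_(size cs) -> R) (x : X2),
     (forall i, 0 <= b i <= 1) -> ble 0 x ->
     \sum_i b i * (nth e0 cs i).2 x <= (if c is ClassCp then 1 else gamma_p p) * `|x| *
       (\sum_i b i `^ s * w i) `^ q^-1].
  apply: exists_weights => // [i|x x0]; first by case: (comp i (ltn_ord i)).
  by rewrite s2'; exact: e0_norm2.
(* The mean of the two weights, extended by [0] beyond the cells. *)
pose h (i : nat) : R := if insub i is Some j then (w j + w' j) / 2 else 0.
have hE (i : 'I_(size cs)) : h i = (w i + w' i) / 2 by rewrite /h valK.
have h0 i : 0 <= h i by rewrite /h; case: insub => // j; rewrite divr_ge0// addr_ge0.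
have h1 : \sum_(i < size cs) h i <= 1.
  under eq_bigr do rewrite hE.
  by rewrite -mulr_suml big_split/=; move: w1 w'1; lra.
have b1 (b : nat -> R) (y : X1) : (forall i, 0 <= b i <= 1) -> ble 0 y ->
    \sum_(i < size cs) b i * (nth e0 cs i).1 y <=
    K_class c p * `|y| * (\sum_(i < size cs) b i `^ s * h i) `^ q^-1.
  move=> b01 y0; apply: (average_bound w0 w'0 hE (normr_ge0 y)).
  exact: (wb (fun i => b i)).
have b2 (b : nat -> R) (y : X2) : (forall i, 0 <= b i <= 1) -> ble 0 y ->
    \sum_(i < size cs) b i * (nth e0 cs i).2 y <=
    K_class c p * `|y| * (\sum_(i < size cs) b i `^ s * h i) `^ q^-1.
  move=> b01 y0; apply: (average_bound w'0 w0 _ (normr_ge0 y)).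
    by move=> i; rewrite hE addrC.
  exact: (w'b (fun i => b i)).
exists (Datum k comp s1' h0 h1 b1 b2); split=> // l lL i /= /nthP[_ _]; exact.
Qed.

Definition datum_filter : set_system datum := [set A | exists L k, forall d,
  (forall l, List.In l L -> datum_exact d l) -> (k <= dt_rank d)%N -> A d]%classic.

Lemma datum_filter_proper : ProperFilter datum_filter.
Proof.
apply: Build_ProperFilter.
  by move=> [L [k h]]; have [d [dL dk]] := exists_datum L k; exact: h dL dk.
split.
- by exists [::], 0%N.
- move=> A B [L [k hA]] [L' [k' hB]]; exists (L ++ L'), (maxn k k') => d dL dk.
  split; [apply: hA|apply: hB].
  + by move=> l lL; apply: dL; apply: List.in_or_app; left.
  + exact: leq_trans (leq_maxl _ _) dk.
  + by move=> l lL; apply: dL; apply: List.in_or_app; right.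
  + exact: leq_trans (leq_maxr _ _) dk.
- by move=> A B AB [L [k hA]]; exists L, k => d dL dk; apply: AB; exact: hA.
Qed.

#[local] Existing Instance datum_filter_proper.

Lemma datum_rank_cvg k : datum_filter [set d | (k <= dt_rank d)%N]%classic.
Proof. by exists [::], k. Qed.

Lemma datum_exact_near l : datum_filter [set d | datum_exact d l]%classic.
Proof. by exists [:: l], 0%N => d dl _; apply: dl; left. Qed.

Definition amalgam_data : prod_data R :=
  @ProdData R datum datum_filter datum_filter_proper (fun d => size (dt_cells d))
    dt_weight dt_rank s q^-1 datum_rank_cvg.

Notation Z := (rp_lattice amalgam_data).

Definition vec1 (y : X1) : pvec amalgam_data := fun d i => (nth e0 (dt_cells d) i).1 y.
Definition vec2 (y : X2) : pvec amalgam_data := fun d i => (nth e0 (dt_cells d) i).2 y.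

Lemma ebound_vec1 y : ebound (vec1 y) (K_class c p * `|y|).
Proof.
apply: filterS filterT => d _ b b01; rewrite -(bnorm_abs y).
apply: le_trans (dt_bound1 d b01 (babs_ge0 y)); apply: ler_sum => i _.
apply: ler_wpM2l; first by case/andP: (b01 i).
by apply: abs_pos_form; case: (dt_compatible (ltn_ord i)).
Qed.

Lemma ebound_vec2 y : ebound (vec2 y) (K_class c p * `|y|).
Proof.
apply: filterS filterT => d _ b b01; rewrite -(bnorm_abs y).
apply: le_trans (dt_bound2 d b01 (babs_ge0 y)); apply: ler_sum => i _.
apply: ler_wpM2l; first by case/andP: (b01 i).
by apply: abs_pos_form; case: (dt_compatible (ltn_ord i)).
Qed.

Lemma bounded_vec1 y : bounded_vec (vec1 y).
Proof.
by exists (K_class c p * `|y|); [rewrite mulr_ge0// ltW// K_class_gt0|exact: ebound_vec1].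
Qed.

Lemma bounded_vec2 y : bounded_vec (vec2 y).
Proof.
by exists (K_class c p * `|y|); [rewrite mulr_ge0// ltW// K_class_gt0|exact: ebound_vec2].
Qed.

Definition leg1 (y : X1) : Z := rp_proj (vec1 y).
Definition leg2 (y : X2) : Z := rp_proj (vec2 y).

Lemma leg1_hom : lattice_hom leg1.
Proof.
split; [|split].
- move=> y z; rewrite /leg1 -rp_projD; try exact: bounded_vec1.
  apply: rp_proj_near; [exact: bounded_vec1|by apply: bounded_vadd; exact: bounded_vec1|].
  apply: filterS filterT => d _ i /= id; rewrite /vec1 /vadd.
  by case: (dt_compatible id) => pf _ _; rewrite (pos_formD pf).
- move=> a y; rewrite /leg1 -rp_projZ; last exact: bounded_vec1.
  apply: rp_proj_near; [exact: bounded_vec1|by apply: boundedZ; exact: bounded_vec1|].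
  apply: filterS filterT => d _ i /= id; rewrite /vec1 /vscale.
  by case: (dt_compatible id) => pf _ _; rewrite (pos_formZ pf).
- move=> y z; rewrite /leg1 -rp_proj_sup; try exact: bounded_vec1.
  apply: rp_proj_near; [exact: bounded_vec1|by apply: bounded_vmax; exact: bounded_vec1|].
  (* A form exact on [y - z] respects the supremum of [y] and [z], and eventually every cell is
     exact there. *)
  apply: filterS (datum_exact_near (inl (y - z))) => d /= ex i id; rewrite /vec1 /vmax.
  by case: (dt_compatible id) => pf _ _; rewrite (exact_on_bsup pf)//; exact: (ex i id).
Qed.

Lemma leg2_hom : lattice_hom leg2.
Proof.
split; [|split].
- move=> y z; rewrite /leg2 -rp_projD; try exact: bounded_vec2.
  apply: rp_proj_near; [exact: bounded_vec2|by apply: bounded_vadd; exact: bounded_vec2|].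
  apply: filterS filterT => d _ i /= id; rewrite /vec2 /vadd.
  by case: (dt_compatible id) => _ pf _; rewrite (pos_formD pf).
- move=> a y; rewrite /leg2 -rp_projZ; last exact: bounded_vec2.
  apply: rp_proj_near; [exact: bounded_vec2|by apply: boundedZ; exact: bounded_vec2|].
  apply: filterS filterT => d _ i /= id; rewrite /vec2 /vscale.
  by case: (dt_compatible id) => _ pf _; rewrite (pos_formZ pf).
- move=> y z; rewrite /leg2 -rp_proj_sup; try exact: bounded_vec2.
  apply: rp_proj_near; [exact: bounded_vec2|by apply: bounded_vmax; exact: bounded_vec2|].
  apply: filterS (datum_exact_near (inr (y - z))) => d /= ex i id; rewrite /vec2 /vmax.
  by case: (dt_compatible id) => _ pf _; rewrite (exact_on_bsup pf)//; exact: (ex i id).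
Qed.

Lemma leg1_le : opnorm_le leg1 (K_class c p).
Proof.
move=> y; rewrite /leg1 rp_proj_norm; last exact: bounded_vec1.
by apply: pseudo_norm_le; [rewrite mulr_ge0// ltW// K_class_gt0|exact: ebound_vec1].
Qed.

Lemma leg2_le : opnorm_le leg2 (K_class c p).
Proof.
move=> y; rewrite /leg2 rp_proj_norm; last exact: bounded_vec2.
by apply: pseudo_norm_le; [rewrite mulr_ge0// ltW// K_class_gt0|exact: ebound_vec2].
Qed.

Lemma legs_commute w : leg1 (T1 w) = leg2 (T2 w).
Proof.
apply: rp_proj_near; [exact: bounded_vec1|exact: bounded_vec2|].
by apply: filterS filterT => d _ i /= id; case: (dt_compatible id) => _ _ /(_ w).
Qed.

Lemma amalgam_in_class : in_class c p Z.
Proof.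
have w0 (d : pd_index amalgam_data) i : 0 <= pd_weight d i := dt_weight_ge0 d i.
have s1 : 1 <= pd_exp amalgam_data.
  rewrite /= /s /class_exp; case: (c) => //.
  by have := conj_exp_gt1 p_gt1 erefl; lra.
have r : pd_root amalgam_data = (p / (p - 1))^-1 by [].
have classP (c' : lattice_class) (Y : BanachLattice R) :
    (class_exp c' p = p / (p - 1) -> in_Cp p Y) -> (class_exp c' p = 1 -> in_Cpinf p Y) ->
    in_class c' p Y.
  by case: c' => [h _|_ h]; exact: h.
apply: classP => sE; first exact: (rp_in_Cp p_gt1 erefl w0 s1 r sE).
exact: (rp_in_Cpinf p_gt1 erefl w0 s1 r sE).
Qed.

(** In the test [b = 1], exactness on [x] turns the sum of absolute values into [e0.1 (babs x)],
    while the gauge is at most [1] because the weights have mass at most [1]. *)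
Lemma leg1_ge x : e0.1 (babs x) <= `|leg1 x|.
Proof.
rewrite /leg1 rp_proj_norm; last exact: bounded_vec1.
apply/ler_addgt0Pl => eps eps0.
have := pseudo_norm_lt (bounded_vec1 x) (_ : pseudo_norm (vec1 x) < eps + pseudo_norm (vec1 x)).
rewrite ltrDr => /(_ eps0) xr.
have [d [/= dx dr]] := filter_ex (filterI (datum_exact_near (inl x)) xr).
have b01 (i : nat) : 0 <= (1 : R) <= 1 by rewrite ler01 lexx.
have := dr (fun=> 1) b01.
have -> : \sum_(i < pd_size (p := amalgam_data) d) 1 * `|vec1 x d i| = e0.1 (babs x).
  rewrite -(dt_sum d); apply: eq_bigr => i _; rewrite mul1r.
  case: (dt_compatible (ltn_ord i)) => pf _ _; rewrite (exact_on_babs pf)//.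
  exact: (dx i (ltn_ord i)).
move=> /le_trans; apply; rewrite -[leRHS]mulr1; apply: ler_wpM2l.
  by rewrite addr_ge0 ?pseudo_norm_ge0// ltW.
apply: (@le_trans _ _ (1 `^ q^-1)); last by rewrite powR1.
apply: powR_le; first by rewrite invr_ge0 ltW.
  by apply: sumr_ge0 => i _; rewrite mulr_ge0 ?powR_ge0//; exact: dt_weight_ge0.
by apply: le_trans (dt_weight_le1 d); apply: ler_sum => i _; rewrite powR1 mul1r.
Qed.

End Amalgam.

Theorem mainTheorem16 (R : realType) (p : R) (c : lattice_class)
    (X0 X1 X2 PO : BanachLattice R) (T1 : X0 -> X1) (T2 : X0 -> X2)
    (T1t : X1 -> PO) (T2t : X2 -> PO) :
  1 < p ->
  in_class c p X0 -> in_class c p X1 -> in_class c p X2 ->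
  lattice_hom T1 -> opnorm_le T1 1 ->
  lattice_isometric_embedding T2 ->
  isometric_pushout c p T1 T2 T1t T2t ->
  forall x : X1, (K_class c p)^-1 * `|x| <= `|T1t x| /\ `|T1t x| <= `|x|.
Proof.
move=> p1 _ XC1 XC2 hT1 nT1 [hT2 nT2] [_ [_ nT1t] _ _ univ] x.
split; last by have := nT1t x; rewrite mul1r.
have [f [pf f1 fx]] := norming_pos_form (babs x).
rewrite (bpos_id (babs_ge0 x)) bnorm_abs in fx.
(* The contraction [T1] and the isometry [T2] give [f (T1 w) <= |T1 w| <= |w| = |T2 w|], so the
   extension to [X2] costs no norm. *)
have fT (w : X0) : ble 0 w -> (f \o T1) w <= `|T2 w|.
  by move=> _; rewrite nT2; apply: le_trans (f1 _) _; have := nT1 w; rewrite mul1r.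
have [g [pg gN gT]] := pos_form_extension hT2 (pos_form_comp hT1 pf) (bnorm_pos_sublinear X2) fT.
pose e0 : cell X1 X2 := (f, g).
have ce0 : compatible T1 T2 e0 by split=> // w; rewrite /= gT.
have n1 (y : X1) : ble 0 y -> e0.1 y <= `|y| by move=> _; exact: f1.
have n2 (y : X2) : ble 0 y -> e0.2 y <= `|y|.
  by move=> _; apply: le_trans (gN y) (bnorm_bpos y).
have [k [_ k1 _ kN _]] := univ _ _ _ (amalgam_in_class p1 XC1 XC2 hT1 hT2 ce0 n1 n2)
  (leg1_hom p1 XC1 XC2 hT1 hT2 ce0 n1 n2) (leg2_hom p1 XC1 XC2 hT1 hT2 ce0 n1 n2)
  (legs_commute p1 XC1 XC2 hT1 hT2 ce0 n1 n2).
have K0 := K_class_gt0 c p1.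
(* The chain is [|x| = f (babs x) <= |leg1 x| = |k (T1t x)| <= K |T1t x|], with [K] the class
   constant. *)
rewrite ler_pdivrMl// -fx; apply: le_trans (leg1_ge p1 XC1 XC2 hT1 hT2 ce0 n1 n2 x) _.
rewrite -k1; apply: kN; [exact: leg1_le|exact: leg2_le].
Qed.
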